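(* Let $f:\mathbb{C}\to\mathbb{C}$ be a transcendental entire function, let $R>0$ be such that $M(r,f)>r$ for all $r\ge R$, and let $A_R(f)$ be a spider's web. Then there is no path to infinity on which $f$ is bounded, and so (a) $f$ does not belong to the Eremenko--Lyubich class $\mathcal{B}$; (b) $f$ has no exceptional points (that is, points with a finite backwards orbit).
   Context: $\mathbb{N}=\{1,2,\dots\}$; $f^n$ denotes the $n$th iterate of $f$. $M(r,f)=\max_{|z|=r}|f(z)|$ for $r>0$, and $M^n(r,f)$ denotes the $n$th iterate of $r\mapsto M(r,f)$. $A_R(f)=\{z: |f^n(z)|\ge M^n(R,f)\text{ for all } n\in\mathbb{N}\}$. A set $E\subset\mathbb{C}$ is a spider's web if $E$ is connected and there exists a sequence of bounded simply connected domains $G_n$, $n\in\mathbb{N}$, with $G_n\subset G_{n+1}$ and $\partial G_n\subset E$ for all $n\in\mathbb{N}$, and $\bigcup_{n\in\mathbb{N}}G_n=\mathbb{C}$. The class $\mathcal{B}$ consists of the transcendental entire functions $f$ for which the set $\operatorname{sing}(f^{-1})$ of critical values and finite asymptotic values of $f$ is bounded. The backwards orbit of a point $\alpha$ is $\bigcup_{n\ge 0}f^{-n}(\{\alpha\})$. *)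

(* Defs.v *)
From HB Require Import structures.
From mathcomp Require Import all_boot all_order all_algebra.
From mathcomp Require Import all_classical all_reals all_analysis.
From mathcomp Require Import complex.

Set Implicit Arguments.
Unset Strict Implicit.
Unset Printing Implicit Defensive.

Import Order.TTheory GRing.Theory Num.Theory.
Import numFieldNormedType.Exports.

Local Open Scope classical_set_scope.
Local Open Scope ring_scope.

(* The complex numbers are [R[i]] with its norm topology. As a normed space,
   [R[i]] is taken over itself, so that [derivable f z 1] is complex
   differentiability at [z] and [derive1 f z] is the complex derivative. The
   norm [`|z|] of [R[i]] takes its values in [R[i]]; the modulus as an element
   of [R] is [Normc.normc z]. *)
HB.instance Definition _ (R : realType) := NormedModule.copy R[i] (R[i]^o).

Section ComplexDynamics.
Variable R : realType.
Local Notation C := R[i].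
Implicit Types (f : C -> C) (E G : set C).

Definition cmod (z : C) : R := Normc.normc z.

Definition entire f : Prop := forall z : C, derivable f z 1.

Definition transcendental_entire f : Prop :=
  entire f /\ ~ (exists p : {poly C}, forall z : C, f z = p.[z]).

(* For continuous [f] and [r >= 0] the circle is compact and nonempty, so this
   supremum is a maximum. *)
Definition max_modulus f (r : R) : R :=
  sup [set cmod (f z) | z in [set z : C | cmod z = r]].

Definition fast_escaping_level f (r : R) : set C :=
  [set z | forall n : nat, (0 < n)%N ->
             iter n (max_modulus f) r <= cmod (iter n f z)].

Definition domain G : Prop := [/\ G !=set0, open G & connected G].

Definition unit_itv : set R := `[0, 1].

Definition loop_in G (gamma : R -> C) : Prop :=
  [/\ {within unit_itv, continuous gamma},
      gamma @` unit_itv `<=` G & gamma 0 = gamma 1].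

(* [H (s, t)] is the homotopy at time [s], evaluated at the parameter [t] of
   the loop; the base point is kept fixed. *)
Definition null_homotopic_in G (gamma : R -> C) : Prop :=
  exists H : R * R -> C,
    [/\ {within unit_itv `*` unit_itv, continuous H},
        H @` (unit_itv `*` unit_itv) `<=` G,
        forall t, unit_itv t -> H (0, t) = gamma t,
        forall t, unit_itv t -> H (1, t) = gamma 0 &
        forall s, unit_itv s -> H (s, 0) = gamma 0 /\ H (s, 1) = gamma 0].

Definition simply_connected_domain G : Prop :=
  domain G /\ forall gamma, loop_in G gamma -> null_homotopic_in G gamma.

Definition boundary E : set C := closure E `\` interior E.

Definition spiders_web E : Prop :=
  connected E /\
  exists G : nat -> set C,
    [/\ forall n, bounded_set (G n) /\ simply_connected_domain (G n),
        forall n, G n `<=` G n.+1,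
        forall n, boundary (G n) `<=` E &
        \bigcup_n G n = setT].

Definition path_to_infinity (gamma : R -> C) : Prop :=
  {within `[0, +oo[, continuous gamma} /\ cmod (gamma t) @[t --> +oo] --> +oo.

Definition bounded_on_path f (gamma : R -> C) : Prop :=
  bounded_set (f @` (gamma @` `[0, +oo[)).

Definition critical_values f : set C :=
  f @` [set z | derive1 f z = 0].

Definition finite_asymptotic_values f : set C :=
  [set a | exists gamma : R -> C,
     path_to_infinity gamma /\ f (gamma t) @[t --> +oo] --> a].

Definition sing_inv f : set C :=
  critical_values f `|` finite_asymptotic_values f.

Definition class_B f : Prop :=
  transcendental_entire f /\ bounded_set (sing_inv f).

Definition backwards_orbit f (alpha : C) : set C :=
  \bigcup_n (iter n f @^-1` [set alpha]).

Definition exceptional_point f (alpha : C) : Prop :=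
  finite_set (backwards_orbit f alpha).

End ComplexDynamics.

(* Main.v *)
(* Write r_m for the iterates M^m(r0). Since |f^m(0)| <= r_m while the frontier
   of f^m(G_n) lies in f^m(A_R) (open mapping), on which |w| >= r_m and
   |f(w)| >= r_(m+1), the bounded domain f^m(G_n) contains the disc of radius r_m
   once 0 lies in G_n. So arbitrarily large discs lie in bounded domains on
   whose frontier |f| is arbitrarily large.

   - A path to infinity crosses these frontiers, so f is unbounded on it.
   - If the fibre of al were bounded, a minimum of |f - al| between two such
     frontiers would contradict the open mapping theorem unless |f - al| >= 1
     outside a bounded set; dividing by the zeros and applying Liouville's
     theorem, f would be a polynomial.
   - If the critical values were bounded by K, then for t > K two points of
     {|f| < t} could not be joined for the first time at the level t, because
     near a point with |f| = t > K the set {|f| < t} is a half disc. All of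
     {|f| < t} would thus be connected, hence contained in one of the bounded
     domains, and f would again be a polynomial.

   The complex analysis is obtained without integrals: Goursat's argument is
   run on midpoint sums, circle integrals are averages over the 2^n-th roots of
   unity, and Cauchy's formula holds in the limit. *)

Require Import Defs.
From mathcomp Require Import all_boot all_order all_algebra.
From mathcomp Require Import all_classical all_reals all_analysis.
From mathcomp Require Import complex.
From mathcomp Require Import ring lra.

Set Implicit Arguments.
Unset Strict Implicit.
Unset Printing Implicit Defensive.

Import Order.TTheory GRing.Theory Num.Theory.
Import numFieldNormedType.Exports.

Local Open Scope classical_set_scope.
Local Open Scope ring_scope.

(** * Topology of the plane *)

Section PlaneTopology.
Variable R : realType.
Local Notation C := R[i].

(** Power series and higher derivatives do not occur. Instead, the difference quotient of an entire
    function at a point, completed there by the derivative, is shown to be entire again. Zeros can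
    thus be divided out one at a time, and the maximum principle carries a bound for a quotient from
    a large circle to its inside. Finite order of zeros, the open mapping theorem, Liouville's
    theorem and the treatment of a bounded zero set all rest on this pair of tools. The web enters
    the three conclusions through the domains of [surrounded] alone. For critical values the
    obstacle is that sublevel sets may be unbounded, so that it is not clear that the infimum of the
    levels joining two points is attained. The surrounding domains supply the compactness for this,
    and links that stay below their level by a fixed margin then allow the attained infimum to be
    undercut. *)

Lemma cmodE (z : C) : `|z| = (cmod z)%:C%C.
Proof. by []. Qed.
Lemma cmod_ge0 (z : C) : 0 <= cmod z.
Proof. by case: z => a b; rewrite /cmod /= sqrtr_ge0. Qed.
Lemma cmodD (x y : C) : cmod (x + y) <= cmod x + cmod y.
Proof. exact: le_normcD. Qed.
Lemma cmodM (x y : C) : cmod (x * y) = cmod x * cmod y.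
Proof. exact: Normc.normcM. Qed.
Lemma cmodN (x : C) : cmod (- x) = cmod x.
Proof. exact: normcN. Qed.
Lemma cmodV (x : C) : cmod x^-1 = (cmod x)^-1.
Proof. exact: Normc.normcV. Qed.
Lemma cmod0 : cmod (0 : C) = 0.
Proof. exact: Normc.normc0. Qed.
Lemma cmod1 : cmod (1 : C) = 1.
Proof. exact: Normc.normc1. Qed.
Lemma cmodX (x : C) n : cmod (x ^+ n) = cmod x ^+ n.
Proof. by elim: n => [|n IH]; rewrite ?expr0 ?cmod1 // !exprS cmodM IH. Qed.
Lemma cmodR (x : R) : cmod (x%:C%C) = `|x|.
Proof. by rewrite /cmod /= expr0n /= addr0 sqrtr_sqr. Qed.
Lemma cmodB (x y : C) : cmod (x - y) = cmod (y - x).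
Proof. by rewrite -cmodN opprB. Qed.
Lemma cmod_eq0 (x : C) : (cmod x == 0) = (x == 0).
Proof. apply/eqP/eqP => [|->]; [exact: Normc.eq0_normc|exact: cmod0]. Qed.
Lemma cmod_gt0 (x : C) : (0 < cmod x) = (x != 0).
Proof. by rewrite lt_neqAle cmod_ge0 andbT eq_sym cmod_eq0. Qed.
Lemma cmodBD (x y z : C) : cmod (x - z) <= cmod (x - y) + cmod (y - z).
Proof. by apply: le_trans (cmodD _ _); rewrite addrA subrK. Qed.
Lemma cmod_sub (x y : C) : cmod x - cmod y <= cmod (x - y).
Proof. by rewrite lerBlDr; apply: le_trans (cmodD _ _); rewrite subrK. Qed.
Lemma cmod_sum (I : Type) (s : seq I) (F : I -> C) :
  cmod (\sum_(i <- s) F i) <= \sum_(i <- s) cmod (F i).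
Proof.
elim: s => [|a s IH]; rewrite ?big_nil ?cmod0 // !big_cons.
by apply: le_trans (cmodD _ _) _; rewrite lerD2l.
Qed.
Lemma Re_le_cmod (x : C) : complex.Re x <= cmod x.
Proof.
case: x => a b /=; rewrite /cmod /=; apply: le_trans (ler_norm _) _.
by rewrite -sqrtr_sqr ler_wsqrtr // lerDl sqr_ge0.
Qed.

(** The norm of [R[i]] and the radii of its balls are complex numbers; a positive one has imaginary
    part 0, so neighbourhoods can be described by real radii. *)
Lemma nbhs_cmod (z : C) (A : set C) :
  nbhs z A <-> exists e : R, 0 < e /\ forall y, cmod (y - z) < e -> A y.
Proof.
split.
  move=> /nbhs_ballP[e /= e0 sub].
  have e_eq : e = (complex.Re e)%:C%C.
    by apply/eqP; rewrite eq_complex /= eqxx /=; move: e0; rewrite ltcE /= => /andP[/eqP ->].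
  exists (complex.Re e); split; first by rewrite -ltcR -e_eq.
  move=> y yz; apply: sub; rewrite -ball_normE /ball_ /= cmodE e_eq ltcR.
  by rewrite cmodB.
move=> [e [e0 sub]]; apply/nbhs_ballP; exists e%:C%C; first by rewrite /= ltcR.
move=> y; rewrite -ball_normE /ball_ /= cmodE ltcR cmodB; exact: sub.
Qed.

Lemma open_cmod (A : set C) :
  open A <-> forall z, A z -> exists e : R, 0 < e /\ forall y, cmod (y - z) < e -> A y.
Proof.
rewrite openE; split=> H z /H; rewrite /interior /=; first by move/nbhs_cmod.
by move=> ?; apply/nbhs_cmod.
Qed.

Lemma closure_cmod (A : set C) z :
  closure A z <-> forall e : R, 0 < e -> exists y, A y /\ cmod (y - z) < e.
Proof.
split.
  move=> cl e e0; have [] := cl [set y | cmod (y - z) < e].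
    by apply/nbhs_cmod; exists e.
  by move=> y [? ?]; exists y.
move=> H B /nbhs_cmod[e [e0 sub]]; have [y [? ?]] := H e e0.
by exists y; split=> //; apply: sub.
Qed.

Lemma continuous_cmod (f : C -> C) z :
  {for z, continuous f} <->
  forall e : R, 0 < e -> exists d : R, 0 < d /\
    forall y, cmod (y - z) < d -> cmod (f y - f z) < e.
Proof.
split.
  move=> cf e e0; have /cf : nbhs (f z) [set y | cmod (y - f z) < e].
    by apply/nbhs_cmod; exists e.
  by move=> /nbhs_cmod.
move=> H B /nbhs_cmod[e [e0 sub]]; have [d [d0 hd]] := H e e0.
by apply/nbhs_cmod; exists d; split=> // y /hd; exact: sub.
Qed.

(** Multiplying the difference quotient by [h] removes the division and includes [h = 0]. *)
Lemma derivable_cmod (f : C -> C) z :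
  derivable f z 1 <-> exists l : C, forall e : R, 0 < e -> exists d : R, 0 < d /\
    forall h, cmod h < d -> cmod (f (z + h) - f z - l * h) <= e * cmod h.
Proof.
split.
  move=> /cvg_ex[l /= cl]; exists l => e e0.
  have /cl /nbhs_cmod [d [d0 hd]] : nbhs l [set y | cmod (y - l) < e].
    by apply/nbhs_cmod; exists e.
  exists d; split=> // h hhd; have [->|h0] := eqVneq h 0.
    by rewrite addr0 subrr mulr0 subr0 cmod0 mulr0.
  have := hd h; rewrite subr0 => /(_ hhd h0) /=.
  rewrite /(_ *: _) /= mulr1 => lt.
  have -> : f (z + h) - f z - l * h = h * (h^-1 * (f (h + z) - f z) - l).
    by rewrite mulrBr mulrA mulfV // mul1r [h + z]addrC (mulrC l).
  by rewrite cmodM mulrC ler_wpM2r ?cmod_ge0 // ltW.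
move=> [l H]; apply/cvg_ex; exists l => B /nbhs_cmod[e [e0 sub]].
have e20 : 0 < e / 2 by rewrite divr_gt0.
have [d [d0 hd]] := H _ e20.
apply/nbhs_cmod; exists d; split=> // h; rewrite subr0 => /hd le h0; apply: sub.
rewrite /= /(_ *: _) /= mulr1.
have -> : h^-1 * (f (h + z) - f z) - l = h^-1 * (f (z + h) - f z - l * h).
  by rewrite [RHS]mulrBr [h + z]addrC (mulrC l h) mulrA mulVf // mul1r.
rewrite cmodM cmodV.
have h0' : 0 < cmod h by rewrite cmod_gt0.
rewrite -ltr_pdivlMl ?invr_gt0 // invrK.
apply: le_lt_trans le _; rewrite mulrC ltr_pM2l //; lra.
Qed.

Lemma derive1_cmod (f : C -> C) z : derivable f z 1 ->
  forall e : R, 0 < e -> exists d : R, 0 < d /\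
    forall h, cmod h < d -> cmod (f (z + h) - f z - derive1 f z * h) <= e * cmod h.
Proof.
move=> df.
have {}df : (fun h => h^-1 *: (f (h + z) - f z)) @ (0:C)^' --> derive1 f z.
  have : derivable f z 1 by [].
  rewrite derive1E => /cvgP.
  rewrite /derivable /derive.
  by under eq_fun do rewrite /= /(_ *: 1) /= mulr1.
move=> e e0.
have /df /nbhs_cmod [d [d0 hd]] : nbhs (derive1 f z : C) [set y | cmod (y - derive1 f z) < e].
  by apply/nbhs_cmod; exists e.
exists d; split=> // h hhd; have [->|h0] := eqVneq h 0.
  by rewrite addr0 subrr mulr0 subr0 cmod0 mulr0.
have := hd h; rewrite subr0 => /(_ hhd h0) /=.
rewrite /(_ *: _) /= => lt.
set l := derive1 f z in lt *.
have -> : f (z + h) - f z - l * h = h * (h^-1 * (f (h + z) - f z) - l).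
  by rewrite mulrBr mulrA mulfV // mul1r [h + z]addrC (mulrC l).
by rewrite cmodM mulrC ler_wpM2r ?cmod_ge0 // ltW.
Qed.

Lemma sqrtD_le (x y : R) : Num.sqrt (x ^+ 2 + y ^+ 2) <= `|x| + `|y|.
Proof.
have le0 : 0 <= `|x| + `|y| by rewrite addr_ge0.
rewrite -[leRHS](ger0_norm le0) -sqrtr_sqr ler_wsqrtr // [leRHS]sqrrD.
rewrite !real_normK ?num_real //.
have : 0 <= `|x| * `|y| by rewrite mulr_ge0.
lra.
Qed.

(** Bolzano-Weierstrass, from compactness of a square in [R * R]. Cluster points take the place of
    subsequences: the limit arguments below pick one large index at a time. *)
Lemma cluster_point (u : nat -> C) (B : R) : (forall n, cmod (u n) <= B) ->
  exists p, forall e, 0 < e -> forall n, exists m, (n <= m)%N /\ cmod (u m - p) < e.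
Proof.
move=> uB.
have cK : compact (`[- B, B] `*` `[- B, B] : set (R * R)%type).
  by apply: compact_setX; apply: segment_compact.
pose v n := (complex.Re (u n), complex.Im (u n)).
have abs_le (x y : R) : `|x| <= Num.sqrt (x ^+ 2 + y ^+ 2).
  by rewrite -sqrtr_sqr ler_wsqrtr // lerDl sqr_ge0.
have Ev : (v @ \oo) (`[- B, B] `*` `[- B, B] : set (R * R)%type).
  exists 0%N => // n _; rewrite /v /=; have := uB n; rewrite /cmod /=; case: (u n) => a b /= uB'.
  rewrite /= !in_itv /= -!ler_norml; split; apply: le_trans uB' => //.
  by rewrite addrC.
have [p [_ clp]] := cK _ _ Ev.
exists (p.1 +i* p.2)%C => e e0 n.
have e20 : 0 < e / 2 by rewrite divr_gt0.
have nb : nbhs p (ball p (e / 2)) by apply: nbhsx_ballx.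
have ev : (v @ \oo) (v @` [set m | (n <= m)%N]) by exists n => // m /= nm; exists m.
have [q [[m /= nm <-] [b1 b2]]] := clp _ _ ev nb.
exists m; split=> //; move: b1 b2; rewrite /ball /= /v /=.
rewrite /cmod; case: (u m) => a b /= b1 b2.
rewrite distrC in b1; rewrite distrC in b2.
have := sqrtD_le (a - p.1) (b - p.2); lra.
Qed.

End PlaneTopology.

(** * Compactness and connectedness in the plane *)

Section PlaneCompactness.
Variable R : realType.
Local Notation C := R[i].

Lemma natSinv_lt (e : R) : 0 < e -> exists n, forall m, (n <= m)%N -> m.+1%:R^-1 < e.
Proof.
move=> e0; exists (Num.bound e^-1) => m nm.
rewrite invf_plt ?posrE ?ltr0n //.
apply: lt_le_trans (_ : (Num.bound e^-1)%:R <= _); last by rewrite ler_nat leqW.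
by apply: archi_boundP; rewrite invr_ge0 ltW.
Qed.

Lemma geometric_lt (B e q : R) : 0 <= q < 1 -> 0 < e ->
  exists n, forall m, (n <= m)%N -> B * q ^+ m < e.
Proof.
move=> /andP[q0 q1] e0.
have B1 : 0 < `|B| + 1 by rewrite ltr_wpDl.
have cv : (fun n => q ^+ n) @ \oo --> (0 : R) by apply: cvg_expr; rewrite ger0_norm.
have [n _ hn] : \forall n \near \oo, `|0 - q ^+ n| < e / (`|B| + 1).
  by move/cvgrPdist_lt : cv; apply; rewrite divr_gt0.
exists n => m nm; have := hn m nm; rewrite sub0r normrN ger0_norm ?exprn_ge0 // => h.
apply: le_lt_trans (_ : (`|B| + 1) * q ^+ m < e); last by rewrite mulrC -ltr_pdivlMr.
by rewrite ler_wpM2r ?exprn_ge0 //; apply: le_trans (ler_norm B) _; rewrite lerDl.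
Qed.

Lemma bounded_on_disc (f : C -> C) (B : R) : continuous f ->
  exists M, 0 < M /\ forall z, cmod z <= B -> cmod (f z) <= M.
Proof.
move=> cf; apply: contrapT => nb.
have H n : exists z, cmod z <= B /\ n%:R < cmod (f z).
  apply: contrapT => /forallNP H; apply: nb; exists n.+1%:R; split=> // z zB.
  rewrite leNgt; apply/negP => lt; apply: (H z); split=> //.
  by apply: le_lt_trans lt; rewrite ler_nat.
have [u hu] := choice H.
have [p hp] := cluster_point (fun n => (hu n).1).
have [d [d0 hd]] := (continuous_cmod f p).1 (cf p) 1 ltr01.
have [m [nm /hd mp]] := hp d d0 (Num.bound (cmod (f p) + 1)).
have [_ lt] := hu m; have := cmod_sub (f (u m)) (f p).
have := archi_boundP (addr_ge0 (cmod_ge0 (f p)) ler01).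
have : (Num.bound (cmod (f p) + 1))%:R <= m%:R :> R by rewrite ler_nat.
lra.
Qed.

Lemma uniformly_continuous_on_disc (f : C -> C) (B e : R) : continuous f -> 0 < e ->
  exists d, 0 < d /\
    forall z w, cmod z <= B -> cmod (w - z) < d -> cmod (f w - f z) < e.
Proof.
move=> cf e0; apply: contrapT => nb.
have H n : exists zw : C * C, [/\ cmod zw.1 <= B, cmod (zw.2 - zw.1) < n.+1%:R^-1 &
    e <= cmod (f zw.2 - f zw.1)].
  apply: contrapT => /forallNP H; apply: nb; exists n.+1%:R^-1; split.
    by rewrite invr_gt0.
  move=> z w zB wz; rewrite ltNge; apply/negP => le; exact: (H (z, w)).
have [u hu] := choice H.
have uB n : cmod (u n).1 <= B by case: (hu n).
have [p hp] := cluster_point uB.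
have e2 : 0 < e / 2 by lra.
have [d [d0 hd]] := (continuous_cmod f p).1 (cf p) _ e2.
have d2 : 0 < d / 2 by lra.
have [N hN] := natSinv_lt d2.
have [m [nm /= mp]] := hp _ d2 N.
have [_ h1 h2] := hu m.
have h3 := lt_trans h1 (hN m nm).
have a1 : cmod (f (u m).1 - f p) < e / 2 by apply: hd; lra.
have a2 : cmod (f (u m).2 - f p) < e / 2.
  by apply: hd; have := cmodBD (u m).2 (u m).1 p; lra.
have := cmodBD (f (u m).2) (f p) (f (u m).1); rewrite (cmodB (f p)); lra.
Qed.

Lemma closure_cluster (A : set C) (u : nat -> C) p : (forall n, A (u n)) ->
  (forall e, 0 < e -> forall n, exists m, (n <= m)%N /\ cmod (u m - p) < e) ->
  closure A p.
Proof.
move=> uA hp; apply/closure_cmod => e e0; have [m [_ lt]] := hp e e0 0%N.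
by exists (u m).
Qed.

Lemma cmod_attains_min (S : set C) (f : C -> C) (B : R) : continuous f ->
  closed S -> (forall z, S z -> cmod z <= B) -> S !=set0 ->
  exists z, S z /\ forall w, S w -> cmod (f z) <= cmod (f w).
Proof.
move=> cf clS SB [z0 Sz0].
pose E := [set cmod (f z) | z in S].
have hE : has_inf E.
  by split; [exists (cmod (f z0)), z0|exists 0 => _ [z _ <-]; exact: cmod_ge0].
have H n : exists z, S z /\ cmod (f z) < inf E + n.+1%:R^-1.
  have n0 : 0 < n.+1%:R^-1 :> R by rewrite invr_gt0.
  by have [_ [z Sz <-] lt] := inf_adherent n0 hE; exists z.
have [u hu] := choice H.
have uB n : cmod (u n) <= B by apply: SB; case: (hu n).
have [p hp] := cluster_point uB.
exists p; split; first by apply: clS; apply: closure_cluster hp => n; case: (hu n).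
move=> w Sw; apply: (@le_trans _ _ (inf E)); last first.
  by apply: ge_inf; [exact: hE.2|exists w].
rewrite leNgt; apply/negP => lt.
have e2 : 0 < (cmod (f p) - inf E) / 2 by lra.
have [d [d0 hd]] := (continuous_cmod f p).1 (cf p) _ e2.
have [N hN] := natSinv_lt e2.
have [m [nm /hd mp]] := hp _ d0 N.
have := (hu m).2; have := hN m nm; move: (m.+1%:R^-1) => iv; have := cmod_sub (f p) (f (u m)).
rewrite cmodB; lra.
Qed.

(** Otherwise [E] would meet [O] in a nonempty proper subset that is both open and closed in [E]. *)
Lemma connected_meets_frontier (E O : set C) z1 z2 : connected E -> open O ->
  E z1 -> O z1 -> E z2 -> ~ O z2 -> exists y, [/\ E y, closure O y & ~ O y].
Proof.
move=> cE oO Ez1 Oz1 Ez2 nOz2; apply: contrapT => H.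
apply: nOz2.
have EO : E `&` O = E.
  apply: cE; first by exists z1.
    by exists O.
  exists (closure O); first exact: closed_closure.
  apply/seteqP; split=> y [Ey Oy]; split=> //; first exact: subset_closure.
  by apply: contrapT => nO; apply: H; exists y.
have : (E `&` O) z2 by rewrite EO.
by case.
Qed.

Definition segment (a b : C) : set C := [set a + t%:C%C * (b - a) | t in `[0, 1]].

Lemma cmod_real (t : R) : 0 <= t -> cmod t%:C%C = t.
Proof. by move=> t0; rewrite cmodR ger0_norm. Qed.

Lemma connected_lipschitz_image (phi : R -> C) (L : R) :
  (forall s t, 0 <= s <= 1 -> 0 <= t <= 1 -> cmod (phi s - phi t) <= L * `|s - t|) ->
  connected [set phi t | t in `[0, 1]].
Proof.
move=> lip; apply: connected_continuous_connected.
  exact: (@segment_connected R 0 1).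
apply/subspace_continuousP => s /= s01 B /nbhs_cmod[e [e0 sub]].
have L1 : 0 < `|L| + 1 by rewrite ltr_wpDl.
apply/nbhs_ballP; exists (e / (`|L| + 1)); first by rewrite /= divr_gt0.
move=> t; rewrite /ball /= => ts t01; apply: sub.
move: s01 t01; rewrite !in_itv /= => s01 t01.
apply: le_lt_trans (lip _ _ t01 s01) _.
rewrite distrC in ts.
apply: (@le_lt_trans _ _ ((`|L| + 1) * `|t - s|)).
  by rewrite ler_wpM2r //; apply: le_trans (ler_norm L) _; rewrite lerDl.
by rewrite mulrC -ltr_pdivlMr.
Qed.

Lemma segment_connectedC a b : connected (segment a b).
Proof.
apply: (@connected_lipschitz_image _ (cmod (b - a))) => s t _ _.
rewrite opprD addrACA subrr add0r -mulrBl -rmorphB cmodM cmodR mulrC.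
by rewrite /=.
Qed.

Lemma segment_left a b : segment a b a.
Proof. by exists 0; rewrite ?mul0r ?addr0 //= in_itv /= lexx ler01. Qed.

Lemma segment_right a b : segment a b b.
Proof. by exists 1; rewrite ?mul1r 1?addrC ?subrK //= in_itv /= lexx ler01. Qed.

Lemma segment_cmod_le a b c (r : R) z : cmod (a - c) <= r -> cmod (b - c) <= r ->
  segment a b z -> cmod (z - c) <= r.
Proof.
move=> ha hb [t /=]; rewrite in_itv /= => /andP[t0 t1] <-.
have -> : a + t%:C%C * (b - a) - c = (1 - t)%:C%C * (a - c) + t%:C%C * (b - c).
  by rewrite rmorphB rmorph1 /=; ring.
apply: le_trans (cmodD _ _) _; rewrite !cmodM !cmod_real ?subr_ge0 //.
have : 0 <= 1 - t by lra.
nra.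
Qed.

End PlaneCompactness.

(** * Goursat's theorem for midpoint sums *)

Section Goursat.
Variable R : realType.
Local Notation C := R[i].
Variable g : C -> C.
Implicit Types (a b c p w z : C) (n k : nat) (e : R).

Definition midpoint a b : C := (a + b) / 2.

(* Midpoint sums for the integral of [g] over the segment from [a] to [b],
   subdivided [n] times. They satisfy the identities of the integral
   exactly, so that the limit is never needed. *)
Fixpoint seg_sum n a b : C :=
  if n is n'.+1 then seg_sum n' a (midpoint a b) + seg_sum n' (midpoint a b) b
  else (b - a) * g (midpoint a b).

Definition tri_sum n a b c := seg_sum n a b + seg_sum n b c + seg_sum n c a.

(** Stands for convexity: the sums evaluate [g] only at repeated midpoints. *)
Definition midpoint_closed (P : set C) := forall a b, P a -> P b -> P (midpoint a b).

Lemma midpointC a b : midpoint b a = midpoint a b.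
Proof. by rewrite /midpoint addrC. Qed.

Lemma cmod2 : cmod (2 : C) = 2.
Proof. by rewrite (_ : (2 : C) = 2%:R%:C%C) ?cmod_real // rmorph_nat. Qed.

Lemma cmod_midpointl a b : cmod (midpoint a b - a) = cmod (b - a) / 2.
Proof.
have -> : midpoint a b - a = (b - a) / 2 by rewrite /midpoint; field.
by rewrite cmodM cmodV cmod2.
Qed.

Lemma cmod_midpointr a b : cmod (b - midpoint a b) = cmod (b - a) / 2.
Proof. by rewrite cmodB midpointC cmod_midpointl cmodB. Qed.

Lemma cmod_midpointB a b c : cmod (midpoint a b - midpoint a c) = cmod (b - c) / 2.
Proof.
have -> : midpoint a b - midpoint a c = (b - c) / 2.
  by rewrite /midpoint; field.
by rewrite cmodM cmodV cmod2.
Qed.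

Lemma midpoint_closed_disc p (r : R) : midpoint_closed [set z | cmod (z - p) <= r].
Proof.
move=> a b /= ha hb; have -> : midpoint a b - p = ((a - p) + (b - p)) / 2.
  by rewrite /midpoint; field.
by rewrite cmodM cmodV cmod2 ler_pdivrMr //; have := cmodD (a - p) (b - p); lra.
Qed.

Lemma seg_sum_rev n a b : seg_sum n b a = - seg_sum n a b.
Proof.
elim: n a b => [|n IH] a b /=; rewrite midpointC; first by rewrite -mulNr opprB.
by rewrite (IH (midpoint a b)) (IH a) opprD addrC.
Qed.

(** The midpoint rule is exact for affine functions: the subtracted term is the integral of
    [al + be * (z - p)] over the segment. The error bound is the same for every depth [n]. *)
Lemma seg_sum_affine (P : set C) (al be p : C) (e : R) n a b : midpoint_closed P ->
  (forall z, P z -> cmod (g z - al - be * (z - p)) <= e) -> P a -> P b ->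
  cmod (seg_sum n a b - (al * (b - a) + be / 2 * ((b - p) ^+ 2 - (a - p) ^+ 2)))
    <= e * cmod (b - a).
Proof.
move=> mP He; elim: n a b => [|n IH] a b Pa Pb /=.
  have -> : (b - a) * g (midpoint a b)
      - (al * (b - a) + be / 2 * ((b - p) ^+ 2 - (a - p) ^+ 2))
      = (b - a) * (g (midpoint a b) - al - be * (midpoint a b - p)).
    by move: (g _) => gm; rewrite /midpoint; field.
  by rewrite cmodM mulrC ler_wpM2r ?cmod_ge0 // He //; apply: mP.
have Pm := mP _ _ Pa Pb.
have h1 := IH _ _ Pa Pm; have h2 := IH _ _ Pm Pb.
move: h1 h2; rewrite cmod_midpointl cmod_midpointr.
set m := midpoint a b; set s1 := seg_sum n a m; set s2 := seg_sum n m b => h1 h2.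
have -> : s1 + s2 - (al * (b - a) + be / 2 * ((b - p) ^+ 2 - (a - p) ^+ 2))
  = (s1 - (al * (m - a) + be / 2 * ((m - p) ^+ 2 - (a - p) ^+ 2)))
  + (s2 - (al * (b - m) + be / 2 * ((b - p) ^+ 2 - (m - p) ^+ 2))).
  by ring.
by apply: le_trans (cmodD _ _) _; lra.
Qed.

Lemma seg_sum_const (P : set C) (al : C) (e : R) n a b : midpoint_closed P ->
  (forall z, P z -> cmod (g z - al) <= e) -> P a -> P b ->
  cmod (seg_sum n a b - al * (b - a)) <= e * cmod (b - a).
Proof.
move=> mP He Pa Pb.
have := @seg_sum_affine P al 0 0 e n a b mP _ Pa Pb.
rewrite !mul0r addr0; apply => z Pz; rewrite mul0r subr0; exact: He.
Qed.

Lemma tri_sum_affine (P : set C) (al be p : C) (e d : R) n a b c :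
  midpoint_closed P -> 0 <= e ->
  (forall z, P z -> cmod (g z - al - be * (z - p)) <= e) -> P a -> P b -> P c ->
  cmod (b - a) <= d -> cmod (c - b) <= d -> cmod (a - c) <= d ->
  cmod (tri_sum n a b c) <= 3 * e * d.
Proof.
move=> mP e0 He Pa Pb Pc hab hbc hca.
have h1 := seg_sum_affine n mP He Pa Pb; have h2 := seg_sum_affine n mP He Pb Pc.
have h3 := seg_sum_affine n mP He Pc Pa.
rewrite /tri_sum; move: h1 h2 h3.
set s1 := seg_sum _ a b; set s2 := seg_sum _ b c; set s3 := seg_sum _ c a => h1 h2 h3.
have -> : s1 + s2 + s3
  = (s1 - (al * (b - a) + be / 2 * ((b - p) ^+ 2 - (a - p) ^+ 2)))
  + (s2 - (al * (c - b) + be / 2 * ((c - p) ^+ 2 - (b - p) ^+ 2)))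
  + (s3 - (al * (a - c) + be / 2 * ((a - p) ^+ 2 - (c - p) ^+ 2))) by ring.
apply: le_trans (cmodD _ _) _.
apply: le_trans (lerD (cmodD _ _) (lexx _)) _.
have := ler_wpM2l e0 hab; have := ler_wpM2l e0 hbc; have := ler_wpM2l e0 hca; lra.
Qed.

Lemma tri_sum_split n a b c : tri_sum n.+1 a b c =
  tri_sum n a (midpoint a b) (midpoint c a) + tri_sum n (midpoint a b) b (midpoint b c)
  + tri_sum n (midpoint c a) (midpoint b c) c
  + tri_sum n (midpoint a b) (midpoint b c) (midpoint c a).
Proof.
rewrite /tri_sum /= [seg_sum n (midpoint b c) (midpoint a b)]seg_sum_rev.
rewrite [seg_sum n (midpoint c a) (midpoint b c)]seg_sum_rev.
rewrite [seg_sum n (midpoint a b) (midpoint c a)]seg_sum_rev; ring.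
Qed.

(** A bound valid for all large [n] replaces the value of the integral, whose existence is never
    discussed. *)
Definition tri_small a b c e :=
  exists n0, forall n, (n0 <= n)%N -> cmod (tri_sum n a b c) <= e.

Lemma tri_small_split a b c e1 e2 e3 e4 :
  tri_small a (midpoint a b) (midpoint c a) e1 ->
  tri_small (midpoint a b) b (midpoint b c) e2 ->
  tri_small (midpoint c a) (midpoint b c) c e3 ->
  tri_small (midpoint a b) (midpoint b c) (midpoint c a) e4 ->
  tri_small a b c (e1 + e2 + e3 + e4).
Proof.
move=> [n1 h1] [n2 h2] [n3 h3] [n4 h4].
exists (maxn (maxn n1 n2) (maxn n3 n4)).+1 => -[//|n]; rewrite ltnS !geq_max.
move=> /andP[/andP[l1 l2] /andP[l3 l4]]; rewrite tri_sum_split.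
have := h1 n l1; have := h2 n l2; have := h3 n l3; have := h4 n l4.
set t1 := tri_sum _ a _ _; set t2 := tri_sum _ _ b _; set t3 := tri_sum _ _ _ c.
set t4 := tri_sum _ _ _ _ => a4 a3 a2 a1.
have := cmodD (t1 + t2 + t3) t4; have := cmodD (t1 + t2) t3; have := cmodD t1 t2; lra.
Qed.

(** If a triangle is not small for [e], one of its quarters is not small for [e / 4]. The nested
    triangles shrink to a point [p] of [P], where differentiability makes [g] affine up to an error
    that is too small for this. *)
Lemma goursat (P : set C) a b c e : closed P -> midpoint_closed P ->
  (forall z, P z -> derivable g z 1) -> P a -> P b -> P c -> 0 < e ->
  tri_small a b c e.
Proof.
move=> clP mP dg Pa Pb Pc e0; apply: contrapT => nsmall.
pose d := cmod (b - a) + cmod (c - b) + cmod (a - c) + 1.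
have [lab lbc lca] : [/\ cmod (b - a) <= d, cmod (c - b) <= d & cmod (a - c) <= d].
  by rewrite /d; have := cmod_ge0 (b - a); have := cmod_ge0 (c - b);
    have := cmod_ge0 (a - c); split; lra.
have d0 : 0 < d.
  by rewrite /d; have := cmod_ge0 (b - a); have := cmod_ge0 (c - b);
    have := cmod_ge0 (a - c); lra.
pose dk k := d / 2 ^+ k; pose ek k := e / 4 ^+ k.
have dkS k : dk k.+1 = dk k / 2.
  by rewrite /dk exprS; field; rewrite expf_neq0 //= pnatr_eq0.
have ekS k : ek k.+1 = ek k / 4.
  by rewrite /ek exprS; field; rewrite expf_neq0 //= pnatr_eq0.
have dk_gt0 k : 0 < dk k by rewrite divr_gt0 // exprn_gt0.
pose inv k (T : C * C * C) := [/\ ~ tri_small T.1.1 T.1.2 T.2 (ek k),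
  [/\ P T.1.1, P T.1.2 & P T.2] & [/\ cmod (T.1.2 - T.1.1) <= dk k,
  cmod (T.2 - T.1.2) <= dk k & cmod (T.1.1 - T.2) <= dk k]].
(* The invariant is assumed under the existential quantifier, so that [choice] yields a step
   function on all triangles. *)
have step (kT : nat * (C * C * C)) : exists T', inv kT.1 kT.2 ->
    inv kT.1.+1 T' /\ cmod (T'.1.1 - kT.2.1.1) <= dk kT.1.
  case: kT => k [[x y] z] /=; case: (pselect (inv k (x, y, z))); last first.
    by move=> ninv; exists (x, y, z).
  move=> [/= ns [Px Py Pz] [xy yz zx]].
  have Pxy := mP _ _ Px Py; have Pyz := mP _ _ Py Pz; have Pzx := mP _ _ Pz Px.
  have mzx : cmod (x - z) / 2 <= dk k.+1 by rewrite dkS; lra.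
  have mxy : cmod (y - x) / 2 <= dk k.+1 by rewrite dkS; lra.
  have myz : cmod (z - y) / 2 <= dk k.+1 by rewrite dkS; lra.
  have dd : dk k.+1 <= dk k by rewrite dkS; have := dk_gt0 k; lra.
  have := dk_gt0 k => dk0.
  case: (pselect (tri_small x (midpoint x y) (midpoint z x) (ek k.+1))); last first.
    move=> n1; exists (x, midpoint x y, midpoint z x) => _; split; last first.
      by rewrite /= subrr cmod0 ltW.
    split=> //=; rewrite cmod_midpointl cmod_midpointr; split=> //.
    by rewrite (midpointC x z) cmod_midpointB.
  case: (pselect (tri_small (midpoint x y) y (midpoint y z) (ek k.+1))); last first.
    move=> n2 _; exists (midpoint x y, y, midpoint y z) => _; split; last first.
      by rewrite /= cmod_midpointl; lra.
    split=> //=; rewrite cmod_midpointl cmod_midpointr; split=> //.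
    by rewrite (midpointC y x) cmod_midpointB.
  case: (pselect (tri_small (midpoint z x) (midpoint y z) z (ek k.+1))); last first.
    move=> n3 _ _; exists (midpoint z x, midpoint y z, z) => _; split; last first.
      by rewrite /= cmodB cmod_midpointr; lra.
    split=> //=; rewrite cmod_midpointl cmod_midpointr; split=> //.
    by rewrite (midpointC z y) cmod_midpointB.
  case: (pselect (tri_small (midpoint x y) (midpoint y z) (midpoint z x) (ek k.+1))).
    move=> s4 s3 s2 s1; exfalso; apply: ns.
    have -> : ek k = ek k.+1 + ek k.+1 + ek k.+1 + ek k.+1 by rewrite ekS; lra.
    exact: tri_small_split.
  move=> n4 _ _ _; exists (midpoint x y, midpoint y z, midpoint z x) => _; split; last first.
    by rewrite /= cmod_midpointl; lra.
  split=> //=; split.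
  - by rewrite -(midpointC x y) cmod_midpointB cmodB.
  - by rewrite -(midpointC y z) cmod_midpointB cmodB.
  - by rewrite -(midpointC z x) cmod_midpointB cmodB.
have [F hF] := choice step.
pose T := fix T k := if k is k'.+1 then F (k', T k') else (a, b, c).
have invT k : inv k (T k).
  elim: k => [|k IH]; last by case: (hF (k, T k) IH).
  by split=> //=; rewrite /ek /dk expr0 !divr1.
pose u k := (T k).1.1.
have stepT k : cmod (u k.+1 - u k) <= dk k by case: (hF (k, T k) (invT k)).
(* The right-hand side is the exact partial sum of the geometric series, which lets the induction on
   [j] close. *)
have near_u k j : cmod (u (k + j)%N - u k) <= 2 * dk k - 2 * dk (k + j)%N.
  elim: j => [|j IH]; first by rewrite addn0 !subrr cmod0.
  have := cmodBD (u (k + j.+1)%N) (u (k + j)%N) (u k).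
  by have := stepT (k + j)%N; rewrite addnS dkS; lra.
have uB k : cmod (u k) <= 2 * d + cmod a.
  have := near_u 0%N k; rewrite add0n {1}/dk expr0 divr1 => h.
  have := cmod_sub (u k) (u 0%N); have := dk_gt0 k.
  by move: h; rewrite (_ : u 0%N = a) //; lra.
have [p hp] := cluster_point uB.
have Pp : P p by apply: clP; apply: closure_cluster hp => k; case: (invT k) => _ [].
have p_near k : cmod (u k - p) <= 2 * dk k.
  apply/ler_addgt0Pr => t t0; have [m [km lt]] := hp t t0 k.
  have := near_u k (m - k)%N; rewrite subnKC // => h.
  have := cmodBD (u k) (u m) p; rewrite (cmodB (u k) (u m)); have := dk_gt0 m; lra.
have /derivable_cmod [l hl] := dg p Pp.
(* A triangle of rank [k] lies within [3 * dk k] of [p] and has sides of length at most [dk k]. With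
   eta this constant, [tri_sum_affine] gives the bound [3 * (eta * (3 * dk k)) * dk k], which is
   [ek k]. *)
have eta0 : 0 < e / (9 * d ^+ 2) by rewrite divr_gt0 // mulr_gt0 // exprn_gt0.
have [rho [rho0 hrho]] := hl _ eta0.
have [k hk] := @geometric_lt R (3 * d) rho 2^-1 ltac:(lra) rho0.
have {hk} : 3 * dk k < rho by have := hk k (leqnn k); rewrite exprVn /dk mulrA.
move=> hk.
have [ns [P1 P2 P3] [s1 s2 s3]] := invT k; apply: ns.
have pk := p_near k; rewrite /u in pk.
exists 0%N => n _.
have -> : ek k = 3 * (e / (9 * d ^+ 2) * (3 * dk k)) * dk k.
  have -> : dk k = d / 2 ^+ k by [].
  have -> : ek k = e / (2 ^+ k) ^+ 2 by rewrite /ek (_ : 4 = 2 ^+ 2) -?exprM 1?mulnC //; ring.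
  by field; rewrite (gt_eqF d0) expf_neq0 //= pnatr_eq0.
apply: (@tri_sum_affine [set z | cmod (z - p) <= 3 * dk k] (g p) l p) => //.
- exact: midpoint_closed_disc.
- by rewrite mulr_ge0 ?(ltW eta0) // mulr_ge0 // ltW.
- move=> z /= zp; have := hrho (z - p) (le_lt_trans zp hk).
  rewrite [p + _]addrC subrK => h; apply: le_trans h _.
  by rewrite ler_wpM2l // ltW.
- by rewrite /=; have := dk_gt0 k; lra.
- by rewrite /=; have := cmodBD (T k).1.2 (T k).1.1 p; lra.
- by rewrite /=; have := cmodBD (T k).2 (T k).1.1 p; rewrite (cmodB (T k).2 (T k).1.1); lra.
Qed.

End Goursat.

(** * Goursat with an exceptional vertex, and roots of unity *)

Section GoursatVertex.
Variable R : realType.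
Local Notation C := R[i].
Implicit Types (f g : C -> C) (c w z : C) (e r : R).

Lemma ReD (x y : C) : complex.Re (x + y) = complex.Re x + complex.Re y.
Proof. by case: x; case: y. Qed.

Lemma ReN (x : C) : complex.Re (- x) = - complex.Re x.
Proof. by case: x. Qed.

Lemma Re_half (x : C) : complex.Re (x / 2) = complex.Re x / 2.
Proof.
have -> : (2 : C)^-1 = (2^-1)%:C%C by rewrite fmorphV rmorph_nat.
by case: x => a b /=; rewrite mulr0 subr0.
Qed.

Lemma Re_midpoint c w a b :
  complex.Re (c * (midpoint a b - w)) =
  (complex.Re (c * (a - w)) + complex.Re (c * (b - w))) / 2.
Proof. by rewrite -ReD -Re_half; congr complex.Re; rewrite /midpoint; field. Qed.

Lemma closed_half_plane c w (s : R) : closed [set z | s <= complex.Re (c * (z - w))].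
Proof.
move=> z /closure_cmod cl /=; apply/ler_addgt0Pr => e e0.
have c1 : 0 < cmod c + 1 by rewrite ltr_wpDl ?cmod_ge0.
have [y [/= sy yz]] := cl _ (divr_gt0 e0 c1).
have -> : c * (z - w) = c * (y - w) - c * (y - z) by ring.
rewrite ReD ReN; have := Re_le_cmod (c * (y - z)); rewrite cmodM.
move: yz; rewrite ltr_pdivlMr //; have := cmod_ge0 (y - z); nra.
Qed.

Lemma midpoint_closed_half_plane c w (s : R) :
  midpoint_closed [set z | s <= complex.Re (c * (z - w))].
Proof. by move=> a b /= ha hb; rewrite Re_midpoint; lra. Qed.

(** At [w] itself [g] is only known to be bounded. Of the four quarters of a triangle with vertex
    [w], three stay in a half plane that avoids [w], where [goursat] applies; the fourth is of the
    same kind with half the size. After [i] rounds the crude bound by [B] times the perimeter,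
    initially at most [4 * d'], has been halved [i] times. *)
Lemma goursat_vertex g c w (B d : R) : 0 <= B ->
  (forall z, cmod (z - w) <= d -> cmod (g z) <= B) ->
  (forall z, z != w -> derivable g z 1) ->
  forall i z z' d' e, d' <= d ->
    0 < complex.Re (c * (z - w)) -> 0 < complex.Re (c * (z' - w)) ->
    cmod (z - w) <= d' -> cmod (z' - w) <= d' -> 0 < e ->
  tri_small g w z z' (4 * B * d' / 2 ^+ i + e).
Proof.
move=> B0 gB dg; elim=> [|i IH] z z' d' e dd zp z'p zd z'd e0.
  have d0 : 0 <= d' := le_trans (cmod_ge0 _) zd.
  exists 0%N => n _; rewrite expr0 divr1.
  have bnd a b : cmod (a - w) <= d' -> cmod (b - w) <= d' ->
      cmod (seg_sum g n a b) <= B * cmod (b - a).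
    move=> ha hb; have := @seg_sum_const R g [set z | cmod (z - w) <= d'] 0 B n a b.
    rewrite mul0r subr0; apply=> //; first exact: midpoint_closed_disc.
    by move=> y /= yd; rewrite subr0 gB //; lra.
  have ww : cmod (w - w) <= d' by rewrite subrr cmod0.
  have h1 := bnd _ _ ww zd; have h2 := bnd _ _ zd z'd; have h3 := bnd _ _ z'd ww.
  have := cmodD (seg_sum g n w z + seg_sum g n z z') (seg_sum g n z' w).
  have := cmodD (seg_sum g n w z) (seg_sum g n z z').
  have := cmodBD z' w z; rewrite -/(tri_sum g n w z z') (cmodB w z).
  by rewrite (cmodB w z') in h3; nra.
(* A midpoint with [w] has half the height above the line through [w], hence the division by 2. *)
pose s := Num.min (complex.Re (c * (z - w))) (complex.Re (c * (z' - w))) / 2.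
have s0 : 0 < s by rewrite divr_gt0 // lt_min zp z'p.
have sz : s <= complex.Re (c * (z - w)) / 2 by rewrite ler_pM2r // ge_min lexx.
have sz' : s <= complex.Re (c * (z' - w)) / 2 by rewrite ler_pM2r // ge_min lexx orbT.
pose P := [set z | s <= complex.Re (c * (z - w))].
have e4 : 0 < e / 4 by lra.
have small a b c' : P a -> P b -> P c' -> tri_small g a b c' (e / 4).
  move=> Pa Pb Pc; apply: (@goursat R g P) => //.
  - exact: closed_half_plane.
  - exact: midpoint_closed_half_plane.
  - move=> y Py; apply: dg; apply/eqP => yw; move: Py.
    by rewrite /P /= yw subrr mulr0 /=; lra.
have w0 : complex.Re (c * (w - w)) = 0 by rewrite subrr mulr0.
have Pz : P z by rewrite /P /=; lra.
have Pz' : P z' by rewrite /P /=; lra.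
have Pwz : P (midpoint w z) by rewrite /P /= Re_midpoint w0; lra.
have Pz'w : P (midpoint z' w) by rewrite /P /= Re_midpoint w0; lra.
have Pzz' : P (midpoint z z') by apply: midpoint_closed_half_plane.
have -> : 4 * B * d' / 2 ^+ i.+1 + e
    = (4 * B * (d' / 2) / 2 ^+ i + e / 4) + e / 4 + e / 4 + e / 4.
  by rewrite exprS; field; rewrite expf_neq0 //= pnatr_eq0.
have d0 : 0 <= d' := le_trans (cmod_ge0 _) zd.
apply: tri_small_split; try exact: small.
apply: IH => //; rewrite ?Re_midpoint ?w0 ?cmod_midpointl; try lra.
by rewrite midpointC cmod_midpointl; lra.
Qed.

End GoursatVertex.

(** * Roots of unity whose order is a power of two *)

Section RootsOfUnity.
Variable R : realType.
Local Notation C := R[i].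

(* [root2 n] is the primitive root of unity of order [2 ^ n.+1] with the
   smallest argument: each one is the half-angle square root of the previous. *)
Fixpoint root2 (n : nat) : C :=
  if n is n'.+1 then
    (Num.sqrt ((1 + complex.Re (root2 n')) / 2) +i*
     Num.sqrt ((1 - complex.Re (root2 n')) / 2))%C
  else -1.

Lemma root2_norm n :
  complex.Re (root2 n) ^+ 2 + complex.Im (root2 n) ^+ 2 = 1 /\ 0 <= complex.Im (root2 n).
Proof.
elim: n => [|n [IH _]] /=; first by rewrite oppr0 expr0n /= addr0 sqrrN expr1n.
have h : -1 <= complex.Re (root2 n) <= 1.
  by have y2 := sqr_ge0 (complex.Im (root2 n)); apply/andP; split; nra.
by rewrite !sqr_sqrtr ?sqrtr_ge0; lra.
Qed.

Lemma root2_Re n : -1 <= complex.Re (root2 n) <= 1.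
Proof.
have [h _] := root2_norm n.
by have y2 := sqr_ge0 (complex.Im (root2 n)); apply/andP; split; nra.
Qed.

Lemma cmod_root2 n : cmod (root2 n) = 1.
Proof.
have [h _] := root2_norm n; rewrite /cmod; case: (root2 n) h => a b /= ->.
exact: sqrtr1.
Qed.

Lemma root2_sqr n : root2 n.+1 ^+ 2 = root2 n.
Proof.
have [h y0] := root2_norm n; have /andP[lb ub] := root2_Re n.
rewrite expr2 /=; move: h y0 lb ub; case: (root2 n) => a b /= h y0 lb ub.
have s1 : Num.sqrt ((1 + a) / 2) ^+ 2 = (1 + a) / 2 by rewrite sqr_sqrtr //; lra.
have s2 : Num.sqrt ((1 - a) / 2) ^+ 2 = (1 - a) / 2 by rewrite sqr_sqrtr //; lra.
have s3 : Num.sqrt ((1 + a) / 2) * Num.sqrt ((1 - a) / 2) = b / 2.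
  rewrite -sqrtrM; last lra.
  have -> : (1 + a) / 2 * ((1 - a) / 2) = (b / 2) ^+ 2.
    have b2 : b ^+ 2 = 1 - a ^+ 2 by lra.
    by rewrite expr_div_n b2; field.
  by rewrite sqrtr_sqr ger0_norm //; lra.
apply/eqP; rewrite eq_complex /=; apply/andP; split; apply/eqP; first by lra.
by rewrite (mulrC (Num.sqrt ((1 - a) / 2))) s3; lra.
Qed.

Lemma root2_half n : root2 n ^+ (2 ^ n) = -1.
Proof. by elim: n => [|n IH]; rewrite ?expr1 // expnS exprM root2_sqr. Qed.

Lemma root2_order n : root2 n ^+ (2 ^ n.+1) = 1.
Proof. by rewrite expnS mulnC exprM root2_half sqrrN expr1n. Qed.

Lemma root2_neq1 n : root2 n != 1.
Proof.
apply/eqP => h; have := root2_half n; rewrite h expr1n => /eqP.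
by rewrite -subr_eq0 opprK (_ : 1 + 1 = 2%:R) ?pnatr_eq0.
Qed.

Lemma root2_neq0 n : root2 n != 0.
Proof. by rewrite -cmod_gt0 cmod_root2 ltr01. Qed.

Lemma root2_cvg (e : R) : 0 < e ->
  exists n0, forall n, (n0 <= n)%N -> cmod (root2 n - 1) < e.
Proof.
move=> e0.
(* If [s] is the new real part, [s ^+ 2 <= s] gives [1 - s <= 1 - s ^+ 2], so the distance of the
   real part from 1 is at least halved in each step. *)
have bnd n : 1 - complex.Re (root2 n) <= 2 * 2^-1 ^+ n.
  elim: n => [|n IH]; first by rewrite expr0 /=; lra.
  have /andP[lb ub] := root2_Re n; rewrite exprS /=.
  set s := Num.sqrt _; have s0 : 0 <= s by rewrite sqrtr_ge0.
  have : s ^+ 2 = (1 + complex.Re (root2 n)) / 2 by rewrite sqr_sqrtr //; lra.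
  have /andP[] := root2_Re n.+1; rewrite /= -/s; nra.
have [n0 hn] := @geometric_lt R 4 (e ^+ 2) 2^-1 ltac:(lra) ltac:(exact: exprn_gt0).
exists n0 => n /hn lt; rewrite -(@ltr_pXn2r _ 2) ?nnegrE ?cmod_ge0 ?ltW //.
have -> : cmod (root2 n - 1) ^+ 2 = 2 * (1 - complex.Re (root2 n)).
  have [h _] := root2_norm n; rewrite /cmod.
  case: (root2 n) h => a b /= h; rewrite oppr0 addr0 sqr_sqrtr ?addr_ge0 ?sqr_ge0 //; lra.
have := bnd n; lra.
Qed.

(** Opposite roots are paired by [1 / (1 - v) + 1 / (1 + v) = 2 / (1 - v ^+ 2)], which replaces [u]
    by [u ^+ 2] and halves the number of terms. The sequence [om] is abstract because the lemma is
    applied to the inverses of [root2]. *)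
Lemma sum_geometric_roots (om : nat -> C) (u : C) n : om 0 = -1 ->
  (forall k, om k.+1 ^+ 2 = om k) -> (forall k, cmod (om k) = 1) -> cmod u < 1 ->
  \sum_(k < 2 ^ n.+1) (1 - u * om n ^+ k)^-1 = (2 ^ n.+1)%:R / (1 - u ^+ (2 ^ n.+1)).
Proof.
move=> om0 omS om1; have half k : om k ^+ (2 ^ k) = -1.
  by elim: k => [|k IH]; rewrite ?expr1 // expnS exprM omS.
have ne1 (v : C) : cmod v < 1 -> 1 - v != 0 /\ 1 + v != 0.
  move=> v1; rewrite subr_eq0 addr_eq0 eq_sym; split; apply/eqP => h; move: v1.
    by rewrite h cmod1 ltxx.
  by rewrite -cmodN -h cmod1 ltxx.
elim: n u => [|n IH] u u1.
  rewrite expn1 big_ord_recl big_ord1 /= expr0 expr1 om0 !mulr1 mulrN1 opprK expr2.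
  have [n1 n2] := ne1 _ u1.
  have n3 : 1 - u * u != 0.
    by rewrite (_ : 1 - u * u = (1 - u) * (1 + u)) ?mulf_neq0 //; ring.
  by field; rewrite n1 n2 n3.
have u21 : cmod (u ^+ 2) < 1 by rewrite cmodX expr_lt1 ?cmod_ge0.
rewrite [in LHS]expnS mul2n -addnn big_split_ord /= -big_split /=.
under eq_bigr => k _.
  have kn1 : cmod (u * om n.+1 ^+ k) < 1 by rewrite cmodM cmodX om1 expr1n mulr1.
  have [n1 n2] := ne1 _ kn1.
  rewrite exprD half mulN1r mulrN opprK.
  have -> : (1 - u * om n.+1 ^+ k)^-1 + (1 + u * om n.+1 ^+ k)^-1
    = 2 * (1 - u ^+ 2 * om n ^+ k)^-1.
    rewrite -(omS n) exprAC; set v := om n.+1 ^+ k in n1 n2 *.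
    rewrite (_ : 1 - u ^+ 2 * v ^+ 2 = (1 - u * v) * (1 + u * v)); last by ring.
    by field; rewrite n1 n2.
  over.
by rewrite -mulr_sumr IH // mulrA -natrM -expnS -exprM -expnS.
Qed.

End RootsOfUnity.

(** * Cauchy's formula *)

Section EntireBasics.
Variable R : realType.
Local Notation C := R[i].
Implicit Types (f g : C -> C) (c w z : C) (e r : R).

Lemma derivable_continuous f z : derivable f z 1 -> {for z, continuous f}.
Proof.
move=> /derivable_cmod[l hl]; apply/continuous_cmod => e e0.
have [d [d0 hd]] := hl 1 ltr01.
have l2 : 0 < cmod l + 2 by have := cmod_ge0 l; lra.
exists (Num.min d (e / (cmod l + 2))); split; first by rewrite lt_min d0 divr_gt0.
move=> y; rewrite lt_min => /andP[/hd + ].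
rewrite [z + _]addrC subrK ltr_pdivlMr // mul1r => h1 h2.
have := cmodD (f y - f z - l * (y - z)) (l * (y - z)); rewrite subrK cmodM.
have := cmod_ge0 (y - z); lra.
Qed.

Lemma derivable_local f g z (d : R) : 0 < d -> (forall y, cmod (y - z) < d -> f y = g y) ->
  derivable f z 1 -> derivable g z 1.
Proof.
move=> d0 fg /derivable_cmod[l hl]; apply/derivable_cmod; exists l => e e0.
have [d1 [d10 hd]] := hl e e0.
exists (Num.min d d1); split; first by rewrite lt_min d0 d10.
move=> h; rewrite lt_min => /andP[h1 h2].
by rewrite -!fg ?hd // ?subrr ?cmod0 // [z + _]addrC addrK.
Qed.

Lemma entire_continuous f : entire f -> continuous f.
Proof. by move=> ef z; apply: derivable_continuous. Qed.

Lemma entire_cst c : entire (fun _ : C => c).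
Proof. by move=> z; apply: derivable_cst. Qed.

Arguments entire_cst : clear implicits.

Lemma entire_id : entire (fun z : C => z).
Proof. by move=> z; apply: derivable_id. Qed.

Arguments entire_id : clear implicits.

Lemma entireB f g : entire f -> entire g -> entire (fun z => f z - g z).
Proof. by move=> ef eg z; apply: derivableB. Qed.

Lemma entireM f g : entire f -> entire g -> entire (fun z => f z * g z).
Proof. by move=> ef eg z; apply: derivableM. Qed.

Lemma entireX f n : entire f -> entire (fun z => f z ^+ n).
Proof.
move=> ef; elim: n => [|n IH]; first exact: entire_cst.
by under eq_fun do rewrite exprS; apply: entireM.
Qed.

Lemma entireV f : entire f -> (forall z, f z != 0) -> entire (fun z => (f z)^-1).
Proof. by move=> ef f0 z; apply: derivableV. Qed.

Lemma entire_shift f c : entire f -> entire (fun z => f (z + c)).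
Proof.
move=> ef z; have /derivable_cmod[l hl] := ef (z + c).
apply/derivable_cmod; exists l => e e0; have [d [d0 hd]] := hl e e0.
by exists d; split=> // h /hd; rewrite [z + c + h]addrAC.
Qed.

Definition quotient_at f w z : C :=
  if z == w then derive1 f w else (f z - f w) / (z - w).

Lemma quotient_atE f w z : f z = f w + (z - w) * quotient_at f w z.
Proof.
rewrite /quotient_at; case: eqVneq => [->|zw]; first by rewrite subrr mul0r addr0.
by rewrite mulrC mulfVK ?subr_eq0 // [RHS]addrC subrK.
Qed.

Lemma derivable_quotient_at f w z : entire f -> z != w -> derivable (quotient_at f w) z 1.
Proof.
move=> ef zw; apply: (@derivable_local (fun y => (f y - f w) * (y - w)^-1) _ _ (cmod (z - w))).
- by rewrite cmod_gt0 subr_eq0.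
- move=> y yz; rewrite /quotient_at; case: eqVneq => // yw.
  by move: yz; rewrite yw cmodB ltxx.
- have d1 := entireB ef (entire_cst (f w)).
  have d2 := entireB entire_id (entire_cst w).
  have d3 : derivable (fun y => (y - w)^-1) z 1 by apply: (derivableV _ (d2 z)); rewrite subr_eq0.
  exact: (derivableM (d1 z) d3).
Qed.

Lemma continuous_quotient_at f w : entire f -> continuous (quotient_at f w).
Proof.
move=> ef z; have [->|zw] := eqVneq z w; last exact/derivable_continuous/derivable_quotient_at.
apply/continuous_cmod => e e0; have e2 : 0 < e / 2 by lra.
have [d [d0 hd]] := derive1_cmod (ef w) e2.
exists d; split=> // y yd; rewrite {2}/quotient_at eqxx.
have [->|yw] := eqVneq y w; first by rewrite /quotient_at eqxx subrr cmod0.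
have := hd _ yd; rewrite [w + _]addrC subrK => h.
have yw0 : 0 < cmod (y - w) by rewrite cmod_gt0 subr_eq0.
rewrite /quotient_at (negPf yw) -(ltr_pM2r yw0) -cmodM mulrBl mulfVK ?subr_eq0 //.
by apply: le_lt_trans h _; rewrite ltr_pM2r //; lra.
Qed.

End EntireBasics.

Section CauchyFormula.
Variable R : realType.
Local Notation C := R[i].
Implicit Types (f g : C -> C) (c w z : C) (e r : R).

Definition circle_pt r n k : C := r%:C%C * root2 R n ^+ k.

(** Discrete form of the integral of [F z / z] over the circle, divided by [2 * pi * i]; hence the
    extra factor [z] in the integrand of Cauchy's formula. *)
Definition circ_avg n r (F : C -> C) : C :=
  (\sum_(k < 2 ^ n.+1) F (circle_pt r n k)) / (2 ^ n.+1)%:R.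

Lemma cmod_circle_pt r n k : 0 <= r -> cmod (circle_pt r n k) = r.
Proof. by move=> r0; rewrite cmodM cmod_real // cmodX cmod_root2 expr1n mulr1. Qed.

Lemma cmod_nat n : cmod (n%:R : C) = n%:R.
Proof. by rewrite -(cmod_real (ler0n _ n)) rmorph_nat. Qed.

Lemma cmod_sum_bound n (F : 'I_n -> C) (B : R) : (forall k, cmod (F k) <= B) ->
  cmod (\sum_k F k) <= n%:R * B.
Proof.
move=> FB; apply: le_trans (cmod_sum _ _) _.
apply: le_trans (ler_sum _ (fun k _ => FB k)) _.
by rewrite sumr_const card_ord mulr_natl.
Qed.

Lemma circ_avg_bound n r F (B : R) : 0 <= r -> (forall z, cmod z = r -> cmod (F z) <= B) ->
  cmod (circ_avg n r F) <= B.
Proof.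
move=> r0 FB; have N0 : 0 < (2 ^ n.+1)%:R :> R by rewrite ltr0n expn_gt0.
rewrite cmodM cmodV cmod_nat ler_pdivrMr // mulrC.
by apply: cmod_sum_bound => k; apply: FB; apply: cmod_circle_pt.
Qed.

Lemma circ_avgB n r F G : circ_avg n r F - circ_avg n r G = circ_avg n r (fun z => F z - G z).
Proof. by rewrite -mulrBl -sumrB. Qed.

Lemma circ_avgZ n r c F : c * circ_avg n r F = circ_avg n r (fun z => c * F z).
Proof. by rewrite mulrA mulr_sumr. Qed.

Lemma eq_circ_avg n r F G : 0 <= r -> (forall z, cmod z = r -> F z = G z) ->
  circ_avg n r F = circ_avg n r G.
Proof.
by move=> r0 FG; congr (_ / _); apply: eq_bigr => k _; apply: FG; apply: cmod_circle_pt.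
Qed.

Lemma finite_eventually (N : nat) (P : nat -> nat -> Prop) :
  (forall k, exists n0, forall n, (n0 <= n)%N -> P k n) ->
  exists n, forall k, (k < N)%N -> P k n.
Proof.
move=> H; have [F hF] := choice H.
exists (\max_(k < N) F k) => k kN; apply: hF.
exact: (@leq_bigmax _ (fun k : 'I_N => F k) (Ordinal kN)).
Qed.

(** The triangles with vertex [w] over the chords between consecutive points form a fan. Each is
    small by [goursat_vertex], the sums over the rays from [w] telescope to 0, and those over the
    chords are close to a Riemann sum. As [z k.+1 - z k = z k * (om - 1)], that Riemann sum is
    [om - 1] times the sum in the average. *)
Lemma circ_avg_holomorphic f w r e : entire f -> cmod w < r -> 0 < e ->
  exists n0, forall n, (n0 <= n)%N ->
    cmod (circ_avg n r (fun z => z * quotient_at f w z)) <= e.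
Proof.
move=> ef wr e0; set g := quotient_at f w.
have r0 : 0 < r := le_lt_trans (cmod_ge0 w) wr.
have cg : continuous g := @continuous_quotient_at _ f w ef.
have [B [B0 hB]] := bounded_on_disc (3 * r) cg.
have e1 : 0 < e / (2 * r) by rewrite divr_gt0 // mulr_gt0.
have [d [d0 hd]] := uniformly_continuous_on_disc r cg e1.
(* The bound [d / r] makes the chords shorter than [d]. The bound [1 - cmod w / r] keeps [z k.+1] on
   the same side as [z k] of the line through [w] perpendicular to the direction of [z k]. *)
have [n0 hn0] : exists n0, forall n, (n0 <= n)%N ->
    cmod (root2 R n - 1) < Num.min (d / r) (1 - cmod w / r).
  by apply: root2_cvg; rewrite lt_min divr_gt0 //= subr_gt0 ltr_pdivrMr // mul1r.
exists n0 => n /hn0; rewrite lt_min => /andP[od ow].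
set om := root2 R n in od ow; pose z k := circle_pt r n k.
pose N := (2 ^ n.+1)%N.
have N0 : 0 < N%:R :> R by rewrite ltr0n expn_gt0.
have om1 : 0 < cmod (om - 1) by rewrite cmod_gt0 subr_eq0 root2_neq1.
have zS k : z k.+1 = z k * om by rewrite /z /circle_pt exprSr mulrA.
have zr k : cmod (z k) = r by apply: cmod_circle_pt; exact: ltW.
have zBz k : z k.+1 - z k = z k * (om - 1) by rewrite zS mulrBr mulr1.
have zBr k : cmod (z k.+1 - z k) = r * cmod (om - 1) by rewrite zBz cmodM zr.
(* The total is divided by [om - 1] at the end, so the tolerance must be proportional to
   [cmod (om - 1)]; triangles and chords use up half of [e] each. *)
pose eta := e / (2 * r) * (r * cmod (om - 1)).
have eta0 : 0 < eta by rewrite mulr_gt0 // mulr_gt0.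
have small k : exists j0, forall j, (j0 <= j)%N ->
    cmod (tri_sum g j w (z k) (z k.+1)) <= eta.
  have [i hi] := @geometric_lt R (4 * B * (2 * r)) (eta / 2) 2^-1 ltac:(lra) ltac:(lra).
  have {hi} hi := hi i (leqnn i).
  pose c := (z k)^* % C.
  have cz : complex.Re (c * z k) = r ^+ 2.
    rewrite -(zr k) /c /cmod; case: (z k) => a b /=.
    by rewrite sqr_sqrtr ?addr_ge0 ?sqr_ge0 //; ring.
  have cr : cmod c = r by rewrite -(zr k) /c /cmod; case: (z k) => a b /=; rewrite sqrrN.
  have cw : complex.Re (c * w) <= r * cmod w.
    by apply: le_trans (Re_le_cmod _) _; rewrite cmodM cr.
  have rw : cmod w * r < r ^+ 2 by rewrite expr2 ltr_pM2r.
  have Hz : 0 < complex.Re (c * (z k - w)) by rewrite mulrBr ReD ReN cz; lra.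
  have Hz' : 0 < complex.Re (c * (z k.+1 - w)).
    rewrite mulrBr ReD ReN -(subrK (z k) (z k.+1)) mulrDr ReD cz.
    have := Re_le_cmod (- (c * (z k.+1 - z k))).
    rewrite ReN cmodN cmodM cr zBr.
    have : r * (r * cmod (om - 1)) < r ^+ 2 - cmod w * r.
      have -> : r ^+ 2 - cmod w * r = r * (r * (1 - cmod w / r)).
        by field; rewrite gt_eqF.
      by rewrite !ltr_pM2l.
    lra.
  have gB y : cmod (y - w) <= 2 * r -> cmod (g y) <= B.
    by move=> yw; apply: hB; have := cmod_sub y w; lra.
  have dg y : y != w -> derivable g y 1 by exact: derivable_quotient_at.
  have zd m : cmod (z m - w) <= 2 * r.
    by have := cmodD (z m) (- w); rewrite cmodN zr; lra.
  have eta2 : 0 < eta / 2 by lra.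
  have [j0 hj] := goursat_vertex (ltW B0) gB dg i (lexx _) Hz Hz' (zd _) (zd _) eta2.
  exists j0 => j jj; apply: le_trans (hj j jj) _.
  by move: hi; rewrite exprVn; lra.
have [j hj] := finite_eventually N small.
have fan : \sum_(k < N) tri_sum g j w (z k) (z k.+1)
    = \sum_(k < N) seg_sum g j (z k) (z k.+1).
  have tel : \sum_(k < N) (seg_sum g j w (z k.+1) - seg_sum g j w (z k)) = 0.
    rewrite -(big_mkord xpredT (fun k => seg_sum g j w (z k.+1) - seg_sum g j w (z k))).
    by rewrite telescope_sumr // /z /circle_pt root2_order expr0 subrr.
  rewrite -[LHS]addr0 -[X in _ + X]tel -big_split; apply: eq_bigr => k _ /=.
  by rewrite /tri_sum [seg_sum g j (z k.+1) w]seg_sum_rev; ring.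
have seg_near k : cmod (seg_sum g j (z k) (z k.+1) - g (z k) * (z k.+1 - z k)) <= eta.
  rewrite /eta -(zBr k).
  apply: (@seg_sum_const R g [set y | cmod (y - z k) <= r * cmod (om - 1)]).
  - exact: midpoint_closed_disc.
  - move=> y /= yz; apply/ltW/hd; first by rewrite zr.
    by apply: le_lt_trans yz _; rewrite mulrC -ltr_pdivlMr.
  - by rewrite /= subrr cmod0 mulr_ge0 // ltW.
  - by rewrite /= zBr.
have sum_bound : cmod (\sum_(k < N) g (z k) * (z k.+1 - z k)) <= N%:R * eta + N%:R * eta.
  have -> : \sum_(k < N) g (z k) * (z k.+1 - z k)
      = \sum_(k < N) tri_sum g j w (z k) (z k.+1)
        - \sum_(k < N) (seg_sum g j (z k) (z k.+1) - g (z k) * (z k.+1 - z k)).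
    by rewrite fan -sumrB; apply: eq_bigr => k _; rewrite subKr.
  apply: le_trans (cmodD _ _) _; rewrite cmodN; apply: lerD; apply: cmod_sum_bound => k.
    exact: hj.
  exact: seg_near.
rewrite /circ_avg cmodM cmodV cmod_nat -/N ler_pdivrMr // -(ler_pM2r om1) -cmodM.
have -> : (\sum_(k < N) circle_pt r n k * g (circle_pt r n k)) * (om - 1)
    = \sum_(k < N) g (z k) * (z k.+1 - z k).
  by rewrite mulr_suml; apply: eq_bigr => k _; rewrite zBz -/(z k); ring.
apply: le_trans sum_bound _; rewrite /eta le_eqVlt; apply/orP; left; apply/eqP.
by field; rewrite gt_eqF.
Qed.

(** In [f z = f w + (z - w) * quotient_at f w z] the quotient contributes 0 in the limit, and the
    average of [z / (z - w)] is exactly [1 / (1 - (w / r) ^+ N)], with [N] the number of points. *)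
Lemma cauchy_formula f w r e : entire f -> cmod w < r -> 0 < e ->
  exists n0, forall n, (n0 <= n)%N ->
    cmod (circ_avg n r (fun z => f z * (z / (z - w))) - f w) < e.
Proof.
move=> ef wr e0; have r0 : 0 < r := le_lt_trans (cmod_ge0 w) wr.
have [n1 h1] := circ_avg_holomorphic ef wr (ltac:(lra) : 0 < e / 2).
pose q := cmod w / r.
have q01 : 0 <= q < 1 by rewrite /q divr_ge0 ?cmod_ge0 1?ltW //= ltr_pdivrMr // mul1r.
have q1 : 0 < 1 - q by case/andP: q01; lra.
have [n2 h2] := @geometric_lt R (cmod (f w) / (1 - q)) (e / 2) q q01 ltac:(lra).
exists (maxn n1 n2) => n; rewrite geq_max => /andP[/h1 {}h1 nn2].
pose N := (2 ^ n.+1)%N.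
have {h2} h2 := h2 N (leq_trans nn2 (ltnW (ltn_trans (ltnSn n) (ltn_expl n.+1 (ltnSn 1))))).
have zw z : cmod z = r -> z - w != 0.
  by move=> zr; rewrite subr_eq0; apply/eqP => h; move: wr; rewrite -h zr ltxx.
have z0 z : cmod z = r -> z != 0 by move=> zr; rewrite -cmod_gt0 zr.
have av1 : circ_avg n r (fun z => z / (z - w)) = (1 - (w / r%:C%C) ^+ N)^-1.
  have u1 : cmod (w / r%:C%C) < 1.
    by rewrite cmodM cmodV cmod_real ?ltW //; case/andP: q01.
  have rc0 : r%:C%C != 0 :> C by apply: z0; rewrite cmod_real // ltW.
  have := @sum_geometric_roots R (fun k => (root2 R k)^-1) (w / r%:C%C) n.
  rewrite /= invrN1 => /(_ erefl) sg.
  rewrite /circ_avg -/N -[RHS](mulKf (_ : N%:R != 0)); last first.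
    by rewrite pnatr_eq0 -lt0n /N expn_gt0.
  rewrite mulrC; congr (_ * _); rewrite -sg.
  - apply: eq_bigr => k _.
    have zr : cmod (circle_pt r n k) = r by apply: cmod_circle_pt; exact: ltW.
    have om0 : root2 R n ^+ k != 0 by rewrite expf_neq0 // root2_neq0.
    move: (zw _ zr) (z0 _ zr); rewrite /circle_pt exprVn.
    set v := root2 R n ^+ k in om0 * => a1 a2.
    have -> : 1 - w / r%:C%C * v^-1 = (r%:C%C * v - w) / (r%:C%C * v).
      by field; rewrite om0 rc0.
    by rewrite invf_div.
  - by move=> k; rewrite exprVn root2_sqr.
  - by move=> k; rewrite cmodV cmod_root2 invr1.
  - by [].
have -> : circ_avg n r (fun z => f z * (z / (z - w))) - f w
  = circ_avg n r (fun z => z * quotient_at f w z)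
    + f w * (circ_avg n r (fun z => z / (z - w)) - 1).
  rewrite mulrBr mulr1 addrA; congr (_ - _); rewrite circ_avgZ.
  apply/eqP; rewrite -subr_eq circ_avgB; apply/eqP/eq_circ_avg; first exact: ltW.
  move=> z zr; rewrite /quotient_at -subr_eq0 (negPf (zw _ zr)).
  by field; exact: zw.
apply: le_lt_trans (cmodD _ _) _.
suff : cmod (f w * (circ_avg n r (fun z => z / (z - w)) - 1)) < e / 2 by lra.
rewrite av1; set u := (w / _) ^+ N.
have uE : cmod u = q ^+ N by rewrite cmodX cmodM cmodV cmod_real // ltW.
have qN : q ^+ N <= q.
  case/andP: q01 => qq0 qq1; rewrite -[leRHS]expr1; apply: ler_wiXn2l => //.
    exact: ltW.
  by rewrite /N expn_gt0.
have u1 : 1 - q <= cmod (1 - u).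
  by have := cmod_sub 1 u; rewrite cmod1 uE; lra.
have u0 : 1 - u != 0 by rewrite -cmod_gt0; lra.
have -> : (1 - u)^-1 - 1 = u / (1 - u) by field.
rewrite !cmodM cmodV uE; apply: le_lt_trans h2.
rewrite [leRHS]mulrAC -[leRHS]mulrA; apply: ler_wpM2l; first exact: cmod_ge0.
apply: ler_wpM2l; first by rewrite exprn_ge0 //; case/andP: q01.
by rewrite lef_pV2 ?posrE //; lra.
Qed.

End CauchyFormula.

(** * The maximum principle and division of entire functions *)

Section CauchyConsequences.
Variable R : realType.
Local Notation C := R[i].
Implicit Types (f g : C -> C) (c w z a b h : C) (e r : R).

Lemma maximum_principle0 f r (B : R) w : entire f -> cmod w < r ->
  (forall z, cmod z = r -> cmod (f z) <= B) -> cmod (f w) <= B.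
Proof.
move=> ef wr fB; have r0 : 0 < r := le_lt_trans (cmod_ge0 w) wr.
have B0 : 0 <= B.
  by apply: le_trans (cmod_ge0 _) (fB r%:C%C _); rewrite cmod_real // ltW.
pose K := r / (r - cmod w).
have rw : 0 < r - cmod w by lra.
(* Landau: Cauchy's formula for [f ^+ m] bounds [f w] by [B] up to the factor
   [K ^ (1 / m)]. *)
have landau m : cmod (f w) ^+ m <= B ^+ m * K.
  apply/ler_addgt0Pr => e e0.
  have [n hn] := cauchy_formula (entireX (n := m) ef) wr e0.
  have {hn} := hn n (leqnn n).
  have := @circ_avg_bound R n r (fun z => f z ^+ m * (z / (z - w))) (B ^+ m * K) (ltW r0) _.
  set I := circ_avg _ _ _ => hI hn.
  have : cmod I <= B ^+ m * K.
    apply: hI => z zr; rewrite !cmodM cmodX cmodV zr.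
    apply: ler_pM; rewrite ?exprn_ge0 ?cmod_ge0 //.
    - by rewrite divr_ge0 ?cmod_ge0 // ltW.
    - by rewrite lerXn2r ?nnegrE ?cmod_ge0 // fB.
    - rewrite ler_pM2l // lef_pV2 ?posrE //; last first.
        by have := cmod_sub z w; lra.
      by have := cmod_sub z w; lra.
  by have := cmod_sub (f w ^+ m) I; rewrite cmodB -cmodX; lra.
rewrite leNgt; apply/negP => Bf.
have f0 : 0 < cmod (f w) by lra.
have q01 : 0 <= B / cmod (f w) < 1.
  by rewrite divr_ge0 ?cmod_ge0 //= ltr_pdivrMr // mul1r.
have [n hn] := @geometric_lt R K 1 (B / cmod (f w)) q01 ltr01.
have := hn n (leqnn n); rewrite expr_div_n mulrA ltr_pdivrMr ?exprn_gt0 // mul1r.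
by rewrite ltNge mulrC landau.
Qed.

Lemma maximum_principle f a r (B : R) w : entire f -> cmod (w - a) <= r ->
  (forall z, cmod (z - a) = r -> cmod (f z) <= B) -> cmod (f w) <= B.
Proof.
move=> ef; rewrite le_eqVlt => /orP[/eqP wr fB|wr fB]; first exact: fB.
have eg := @entire_shift R f a ef.
have gB z : cmod z = r -> cmod (f (z + a)) <= B.
  by move=> zr; apply: fB; rewrite addrK.
by have := maximum_principle0 eg wr gB; rewrite subrK.
Qed.

(** For [h != 0], Cauchy's formula shows that the averages [s n h] tend to [q h]. Their difference
    quotients [t n h] differ from [t n 0] by at most [2 * B * cmod h], uniformly in [n], so a
    cluster point of the [t n 0] is the derivative of [q] at 0. *)
Lemma derivable_quotient_at0 f : entire f -> derivable (quotient_at f 0) 0 1.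
Proof.
move=> ef; set q := quotient_at f 0.
have [B [B0 hB]] := bounded_on_disc 1 (entire_continuous ef).
pose s n h := circ_avg n 1 (fun z => f z / (z - h)).
pose t n h := circ_avg n 1 (fun z => f z / (z * (z - h))).
have ge_half h z : cmod h <= 1 / 2 -> cmod z = 1 -> 1 / 2 <= cmod (z - h).
  by move=> hh z1; have := cmod_sub z h; lra.
have inv_half h z : cmod h <= 1 / 2 -> cmod z = 1 -> (cmod (z - h))^-1 <= 2.
  move=> hh z1; have := ge_half _ _ hh z1 => g.
  by rewrite invf_ple ?posrE //; lra.
have zh0 h z : cmod h <= 1 / 2 -> cmod z = 1 -> (z != 0) && (z - h != 0).
  by move=> hh z1; have := ge_half _ _ hh z1; rewrite -!cmod_gt0 z1 ltr01 /=; lra.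
have st n h : cmod h <= 1 / 2 -> s n h - s n 0 = h * t n h.
  move=> hh; rewrite circ_avgB circ_avgZ; apply: eq_circ_avg => // z z1.
  have /andP[n1 n2] := zh0 _ _ hh z1.
  by rewrite subr0; field; rewrite n1 n2.
have tB n h : cmod h <= 1 / 2 -> cmod (t n h - t n 0) <= 2 * B * cmod h.
  move=> hh; rewrite circ_avgB; apply: circ_avg_bound => // z z1.
  have /andP[n1 n2] := zh0 _ _ hh z1.
  have -> : f z / (z * (z - h)) - f z / (z * (z - 0)) = f z * h / (z * z * (z - h)).
    by rewrite subr0; field; rewrite n1 n2.
  rewrite !cmodM cmodV !cmodM z1 !mul1r.
  have := hB z ltac:(by rewrite z1); have := inv_half _ _ hh z1; have := cmod_ge0 (f z).
  have := cmod_ge0 h.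
  set x := cmod (f z); set y := cmod h; set v := _^-1 => y0 x0 v2 xB.
  have : v * (x * y) <= 2 * (B * y).
    by apply: ler_pM; rewrite ?mulr_ge0 ?ler_wpM2r // /v invr_ge0 cmod_ge0.
  lra.
have t0B n : cmod (t n 0) <= B.
  apply: circ_avg_bound => // z z1; rewrite cmodM cmodV cmodM subr0 z1 mulr1 invr1 mulr1.
  by apply: hB; rewrite z1.
have s_cvg h e : h != 0 -> cmod h <= 1 / 2 -> 0 < e ->
    exists n0, forall n, (n0 <= n)%N -> cmod (s n h - q h) <= e.
  move=> h0 hh e0; have hp : 0 < cmod h by rewrite cmod_gt0.
  have eh : 0 < e * cmod h / 2 by rewrite divr_gt0 // mulr_gt0.
  have [n1 h1] := cauchy_formula ef (ltac:(lra) : cmod h < 1) eh.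
  have [n2 h2] := cauchy_formula ef (ltac:(by rewrite cmod0 ltr01) : cmod (0 : C) < 1) eh.
  exists (maxn n1 n2) => n; rewrite geq_max => /andP[/h1 {}h1 /h2 {}h2].
  rewrite -(ler_pM2r hp) -cmodM.
  have -> : (s n h - q h) * h
    = (circ_avg n 1 (fun z => f z * (z / (z - h))) - f h)
      - (circ_avg n 1 (fun z => f z * (z / (z - 0))) - f 0).
    have -> : (s n h - q h) * h = h * s n h - q h * h by ring.
    rewrite {1}/q /quotient_at (negPf h0) subr0 mulfVK //.
    have -> : h * s n h = circ_avg n 1 (fun z => f z * (z / (z - h)))
        - circ_avg n 1 (fun z => f z * (z / (z - 0))).
      rewrite circ_avgB circ_avgZ; apply: eq_circ_avg => // z z1.
      have /andP[m1 m2] := zh0 _ _ hh z1.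
      by rewrite subr0; field; rewrite m1 m2.
    by ring.
  by apply: le_trans (cmodD _ _) _; rewrite cmodN; lra.
(* At [h = 0] Cauchy's formula cannot be divided by [h]. The limit comes instead from a small real
   [x], by continuity of [q] and the estimate [cmod (t n x) <= 3 * B], uniform in [n]. *)
have s0_cvg e : 0 < e -> exists n0, forall n, (n0 <= n)%N -> cmod (s n 0 - q 0) <= e.
  move=> e0; have e3 : 0 < e / 3 by lra.
  have [d [d0 hd]] := (continuous_cmod q 0).1 (@continuous_quotient_at _ f 0 ef 0) _ e3.
  have BB : 0 < 3 * (3 * B) by lra.
  pose x := Num.min (1 / 2) (Num.min (d / 2) (e / (3 * (3 * B)))).
  have x0 : 0 < x by rewrite !lt_min !divr_gt0.
  have x1 : x <= 1 / 2 by rewrite ge_min lexx.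
  have x2 : x <= d / 2 by rewrite !ge_min lexx orbT.
  have : x <= e / (3 * (3 * B)) by rewrite !ge_min lexx !orbT.
  rewrite ler_pdivlMr // => x3.
  have cx : cmod (x%:C%C : C) = x by rewrite cmod_real // ltW.
  have xx : cmod (x%:C%C : C) <= 1 / 2 by rewrite cx.
  have xn0 : (x%:C%C : C) != 0 by rewrite -cmod_gt0 cx.
  have [n0 h0] := s_cvg _ _ xn0 xx e3.
  exists n0 => n /h0 {}h0.
  have h1 : cmod (q x%:C%C - q 0) < e / 3 by apply: hd; rewrite subr0 cx; lra.
  have h2 : cmod (s n 0 - s n x%:C%C) <= e / 3.
    rewrite cmodB st // cmodM cx.
    have := cmodD (t n x%:C%C - t n 0) (t n 0); rewrite subrK.
    have := tB n _ xx; have := t0B n; rewrite cx.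
    set a1 := cmod (t n 0); set a2 := cmod (t n x%:C%C - t n 0); set a3 := cmod _.
    move=> b1 b2 b3; have : a3 <= 3 * B by nra.
    by nra.
  have := cmodBD (s n 0) (s n x%:C%C) (q 0).
  by have := cmodBD (s n x%:C%C) (q x%:C%C) (q 0); lra.
have [b hb] := cluster_point t0B.
have key h : h != 0 -> cmod h <= 1 / 2 -> cmod (q h - q 0 - b * h) <= 2 * B * cmod h * cmod h.
  move=> h0 hh; apply/ler_addgt0Pr => e e0; have e3 : 0 < e / 3 by lra.
  have [n1 h1] := s_cvg _ _ h0 hh e3; have [n2 h2] := s0_cvg _ e3.
  have [m [mm hm]] := hb _ e3 (maxn n1 n2).
  move: mm; rewrite geq_max => /andP[/h1 {}h1 /h2 {}h2].
  have h3 := tB m _ hh.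
  have -> : q h - q 0 - b * h = (q h - s m h) + (s m 0 - q 0)
      + (t m h - t m 0) * h + (t m 0 - b) * h.
    have -> : q h - s m h = q h - (s m 0 + h * t m h) by rewrite -st // [s m 0 + _]addrC subrK.
    by ring.
  apply: le_trans (cmodD _ _) _; apply: le_trans (lerD (cmodD _ _) (lexx _)) _.
  apply: le_trans (lerD (lerD (cmodD _ _) (lexx _)) (lexx _)) _.
  rewrite !cmodM (cmodB (q h)); have := cmod_ge0 h; have := cmod_ge0 (t m 0 - b).
  by nra.
apply/derivable_cmod; exists b => e e0.
have B1 : 0 < 2 * B + 1 by lra.
exists (Num.min (1 / 2) (e / (2 * B + 1))); split.
  by rewrite lt_min !divr_gt0.
move=> h; rewrite lt_min => /andP[h1]; rewrite ltr_pdivlMr // => h2; rewrite add0r.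
have [->|h0] := eqVneq h 0; first by rewrite subrr mulr0 subr0 cmod0 mulr0.
apply: le_trans (key h h0 (ltW h1)) _; rewrite ler_wpM2r ?cmod_ge0 //.
by have := cmod_ge0 h; lra.
Qed.

Lemma entire_quotient_at f w : entire f -> entire (quotient_at f w).
Proof.
move=> ef z; have [->|zw] := eqVneq z w; last exact: derivable_quotient_at.
pose g z := f (z + w).
have eg : entire g by apply: entire_shift.
have gq y : y != 0 -> quotient_at g 0 y = quotient_at f w (y + w).
  move=> y0; rewrite /quotient_at (negPf y0) -subr_eq0 addrK (negPf y0).
  by rewrite /g add0r subr0.
(* Both quotients are continuous and agree off the point, hence also at it. *)
have cont_eq : quotient_at g 0 0 = quotient_at f w w.
  apply/eqP; rewrite -subr_eq0 -cmod_eq0 eq_le cmod_ge0 andbT.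
  apply/ler_addgt0Pr => e e0; rewrite add0r; have e2 : 0 < e / 2 by lra.
  have [d1 [d10 h1]] := (continuous_cmod _ _).1 (@continuous_quotient_at _ g 0 eg 0) _ e2.
  have [d2 [d20 h2]] := (continuous_cmod _ _).1 (@continuous_quotient_at _ f w ef w) _ e2.
  pose x := Num.min d1 d2 / 2.
  have m0 : 0 < Num.min d1 d2 by rewrite lt_min d10.
  have x0 : 0 < x by rewrite /x; lra.
  have m1 : Num.min d1 d2 <= d1 by rewrite ge_min lexx.
  have m2 : Num.min d1 d2 <= d2 by rewrite ge_min lexx orbT.
  have cx : cmod (x%:C%C : C) = x by rewrite cmod_real // ltW.
  have xn0 : (x%:C%C : C) != 0 by rewrite -cmod_gt0 cx.
  have := h1 x%:C%C; rewrite subr0 cx => /(_ ltac:(rewrite /x; lra)).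
  have := h2 (x%:C%C + w); rewrite addrK cx => /(_ ltac:(rewrite /x; lra)).
  rewrite gq //; set u := quotient_at f w (_ + w) => a1 a2.
  by have := cmodBD (quotient_at g 0 0) u (quotient_at f w w); rewrite (cmodB _ u); lra.
have /derivable_cmod[l hl] := derivable_quotient_at0 eg.
apply/derivable_cmod; exists l => e e0; have [d [d0 hd]] := hl e e0.
exists d; split=> // h hlt; have := hd h hlt; rewrite add0r cont_eq.
have [->|h0] := eqVneq h 0; first by rewrite cont_eq addr0.
by rewrite gq // [h + w]addrC.
Qed.

(** The difference of Cauchy's formulas at [z] and [w] on the unit circle contains the factor
    [z - w]; the two remaining denominators are at least 1/2, whence [4 * B]. *)
Lemma lipschitz_near0 f : entire f -> exists L, 0 < L /\
  forall z w, cmod z <= 1 / 2 -> cmod w <= 1 / 2 -> cmod (f z - f w) <= L * cmod (z - w).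
Proof.
move=> ef; have [B [B0 hB]] := bounded_on_disc 1 (entire_continuous ef).
exists (4 * B); split; first by lra.
move=> z w hz hw; apply/ler_addgt0Pr => e e0; have e2 : 0 < e / 2 by lra.
have [n1 h1] := cauchy_formula ef (ltac:(lra) : cmod z < 1) e2.
have [n2 h2] := cauchy_formula ef (ltac:(lra) : cmod w < 1) e2.
have {h1} := h1 _ (leq_maxl n1 n2); have {h2} := h2 _ (leq_maxr n1 n2).
set n := maxn _ _; set I1 := circ_avg _ _ _; set I2 := circ_avg _ _ _ => h2 h1.
have : cmod (I2 - I1) <= 4 * B * cmod (z - w).
  rewrite circ_avgB; apply: circ_avg_bound => // y y1.
  have yz : 1 / 2 <= cmod (y - z) by have := cmod_sub y z; lra.
  have yw : 1 / 2 <= cmod (y - w) by have := cmod_sub y w; lra.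
  have yz0 : y - z != 0 by rewrite -cmod_gt0; lra.
  have yw0 : y - w != 0 by rewrite -cmod_gt0; lra.
  have -> : f y * (y / (y - z)) - f y * (y / (y - w))
      = f y * y * (z - w) * ((y - z)^-1 * (y - w)^-1) by field; rewrite yz0 yw0.
  rewrite !cmodM !cmodV y1 mulr1.
  have i1 : (cmod (y - z))^-1 <= 2 by rewrite invf_ple ?posrE //; lra.
  have i2 : (cmod (y - w))^-1 <= 2 by rewrite invf_ple ?posrE //; lra.
  have : cmod (f y) * cmod (z - w) * ((cmod (y - z))^-1 * (cmod (y - w))^-1)
      <= B * cmod (z - w) * (2 * 2).
    apply: ler_pM; rewrite ?mulr_ge0 ?invr_ge0 ?cmod_ge0 //.
      by rewrite ler_wpM2r ?cmod_ge0 // hB // y1.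
    by apply: ler_pM; rewrite ?invr_ge0 ?cmod_ge0.
  lra.
have := cmodBD (f z) I2 (f w); have := cmodBD I2 I1 (f w); rewrite (cmodB (f z) I2); lra.
Qed.

End CauchyConsequences.

(** * Local behaviour of entire functions *)

Lemma addKl_sub (V : zmodType) (x y : V) : x + y - x = y.
Proof. by rewrite addrC addKr. Qed.

Section LocalBehaviour.
Variable R : realType.
Local Notation C := R[i].
Implicit Types (f g : C -> C) (c w z a b h : C) (e r : R).

Definition nonconstant f := ~ exists c, forall z, f z = c.

(** If [z - a] could be divided out without end, the maximum principle on the circle of radius
    [2 * cmod (z - a)] would bound [f z - f a] by [2 * B / 2 ^ n.+1] for every [n], and [f] would be
    constant. *)
Lemma local_factorization f a : entire f -> nonconstant f ->
  exists k g, [/\ (0 < k)%N, entire g, g a != 0 & forall z, f z = f a + (z - a) ^+ k * g z].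
Proof.
move=> ef nc; apply: contrapT => H.
have divide k : exists q, entire q /\ forall z, f z = f a + (z - a) ^+ k.+1 * q z.
  elim: k => [|k [q [eq fq]]].
    by exists (quotient_at f a); split=> [|z]; [exact: entire_quotient_at|exact: quotient_atE].
  have qa : q a = 0.
    by apply/eqP/negPn/negP => qa; apply: H; exists k.+1, q; split.
  exists (quotient_at q a); split=> [|z]; first exact: entire_quotient_at.
  by rewrite fq {1}(quotient_atE q a z) qa add0r mulrA -exprSr.
apply: nc; exists (f a) => z; apply/eqP; rewrite -subr_eq0 -cmod_eq0 eq_le cmod_ge0 andbT.
apply/ler_addgt0Pr => e e0; rewrite add0r.
have [->|za] := eqVneq z a; first by rewrite subrr cmod0 ltW.
pose r := 2 * cmod (z - a).
have d0 : 0 < cmod (z - a) by rewrite cmod_gt0 subr_eq0.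
have r0 : 0 < r by rewrite mulr_gt0.
have [B [B0 hB]] := bounded_on_disc (cmod a + r) (entire_continuous ef).
have [n hn] := @geometric_lt R (2 * B) e 2^-1 ltac:(lra) e0.
have {hn} hn := hn n.+1 (leqnSn n).
have [q [eq fq]] := divide n.
have qz : cmod (q z) <= 2 * B / r ^+ n.+1.
  apply: (maximum_principle (a := a) (r := r) eq); first by rewrite /r; lra.
  move=> y yr; rewrite ler_pdivlMr ?exprn_gt0 // -yr -cmodX -cmodM mulrC.
  have -> : (y - a) ^+ n.+1 * q y = f y - f a by rewrite fq addKl_sub.
  apply: le_trans (cmodD _ _) _; rewrite cmodN.
  have : cmod (f y) <= B by apply: hB; have := cmod_sub y a; lra.
  have : cmod (f a) <= B by apply: hB; lra.
  lra.
rewrite fq addKl_sub cmodM cmodX; apply: le_trans (ltW hn).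
apply: le_trans (ler_wpM2l _ qz) _; first by rewrite exprn_ge0 // ltW.
rewrite /r exprMn le_eqVlt; apply/orP; left; apply/eqP; rewrite exprVn.
by field; rewrite !expf_neq0 ?gt_eqF //= pnatr_eq0.
Qed.

(** Since [C] is algebraically closed, some [u] satisfies [u ^+ k * g a = - (f a - w)]. Along
    [a + t * u] the main part of [f - w] is then [(1 - t ^+ k) * (f a - w)]. *)
Lemma local_decrease f w a e : entire f -> nonconstant f -> f a != w -> 0 < e ->
  exists z, cmod (z - a) < e /\ cmod (f z - w) < cmod (f a - w).
Proof.
move=> ef nc faw e0; have [k [g [k0 eg ga fE]]] := local_factorization a ef nc.
pose c := f a - w; have c0 : 0 < cmod c by rewrite cmod_gt0 subr_eq0.
pose u := k.-root (- c / g a).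
have uk : u ^+ k * g a = - c by rewrite rootCK // mulfVK.
have U0 : 0 <= cmod u ^+ k by rewrite exprn_ge0 ?cmod_ge0.
have ep : 0 < cmod c / (2 * (cmod u ^+ k + 1)) by rewrite divr_gt0 //; lra.
have [d [d0 hd]] := (continuous_cmod g a).1 (@entire_continuous _ _ eg a) _ ep.
have u1 : 0 < 2 * (cmod u + 1) by have := cmod_ge0 u; lra.
pose m := Num.min d e.
have m0 : 0 < m by rewrite lt_min d0.
pose t := Num.min 1 (m / (2 * (cmod u + 1))).
have t0 : 0 < t by rewrite lt_min ltr01 divr_gt0.
have t1 : t <= 1 by rewrite ge_min lexx.
have : t <= m / (2 * (cmod u + 1)) by rewrite ge_min lexx orbT.
rewrite ler_pdivlMr // => tm.
have dist : cmod (t%:C%C * u) < m.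
  by rewrite cmodM cmod_real ?ltW //; have := cmod_ge0 u; nra.
exists (a + t%:C%C * u); rewrite addKl_sub; split.
  by apply: lt_le_trans dist _; rewrite ge_min lexx orbT.
have gz : cmod (g (a + t%:C%C * u) - g a) < cmod c / (2 * (cmod u ^+ k + 1)).
  by apply: hd; rewrite addKl_sub; apply: lt_le_trans dist _; rewrite ge_min lexx.
have tk0 : 0 < t ^+ k by rewrite exprn_gt0.
have tk1 : t ^+ k <= 1 by rewrite exprn_ile1 // ltW.
rewrite fE addKl_sub; set gt := g _ in gz *.
have -> : f a + (t%:C%C * u) ^+ k * gt - w
    = (1 - t ^+ k)%:C%C * c + (t ^+ k)%:C%C * (u ^+ k * (gt - g a)).
  have -> : u ^+ k * (gt - g a) = u ^+ k * gt + c.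
    by rewrite [LHS]mulrBr uk opprK.
  rewrite exprMn rmorphB rmorph1 !rmorphXn /= /c; ring.
apply: le_lt_trans (cmodD _ _) _; rewrite !cmodM cmodX !cmod_real ?subr_ge0 ?(ltW tk0) //.
have : cmod u ^+ k * cmod (gt - g a) <= cmod c / 2.
  apply: le_trans (ler_wpM2l U0 (ltW gz)) _.
  move: U0; set U := cmod u ^+ k => U0.
  have -> : U * (cmod c / (2 * (U + 1))) = cmod c / 2 * (U / (U + 1)).
    by field; rewrite gt_eqF //; lra.
  by rewrite ler_piMr ?divr_ge0 ?ler_pdivrMr ?cmod_ge0 //; lra.
nra.
Qed.

(** The minimum of [cmod (f z - w)] over a closed disc about [a] is taken inside, because [f] stays
    at distance [mu] from [f a] on the circle; by [local_decrease] this minimum is 0. *)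
Lemma open_mapping f a e : entire f -> nonconstant f -> 0 < e ->
  exists d, 0 < d /\ forall w, cmod (w - f a) < d -> exists z, cmod (z - a) < e /\ f z = w.
Proof.
move=> ef nc e0; have [k [g [k0 eg ga fE]]] := local_factorization a ef nc.
have g2 : 0 < cmod (g a) / 2 by rewrite divr_gt0 // cmod_gt0.
have [d [d0 hd]] := (continuous_cmod g a).1 (@entire_continuous _ _ eg a) _ g2.
pose m := Num.min d e; pose r := m / 2.
have m0 : 0 < m by rewrite lt_min d0.
have [md me] : m <= d /\ m <= e by rewrite !ge_min !lexx orbT.
have r0 : 0 < r by rewrite /r; lra.
pose mu := r ^+ k * (cmod (g a) / 2).
have mu0 : 0 < mu by rewrite mulr_gt0 // exprn_gt0.
exists (mu / 2); split; first by lra.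
move=> w wfa; pose S := [set z | cmod (z - a) <= r].
have clS : closed S.
  move=> z /closure_cmod cl; rewrite /S /=; apply/ler_addgt0Pr => t t0.
  have [y []] := cl t t0; rewrite /S /= => ya yz.
  by have := cmodBD z y a; rewrite (cmodB z y); lra.
have SB z : S z -> cmod z <= cmod a + r by rewrite /S /= => zr; have := cmod_sub z a; lra.
have efw := entireB ef (@entire_cst R w).
have cfw : continuous (fun z => f z - w) := @entire_continuous _ _ efw.
have S0 : S !=set0 by exists a; rewrite /S /= subrr cmod0 ltW.
have [z [Sz zmin]] := cmod_attains_min cfw clS SB S0.
exists z; split; first by rewrite /S /= in Sz; rewrite /r in Sz; lra.
apply/eqP/negPn/negP => fzw.
have zin : cmod (z - a) < r.
  rewrite lt_neqAle Sz andbT; apply/eqP => zr.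
  have := zmin a ltac:(by rewrite /S /= subrr cmod0 ltW).
  have gz : cmod (g z - g a) < cmod (g a) / 2 by apply: hd; rewrite zr /r; lra.
  have : mu <= cmod (f z - f a).
    rewrite fE addKl_sub cmodM cmodX zr /mu ler_pM2l ?exprn_gt0 //.
    by have := cmod_sub (g a) (g z); rewrite (cmodB (g a)); lra.
  by have := cmodBD (f z) w (f a); rewrite (cmodB w) in wfa *; rewrite (cmodB (f a) w) in wfa *; lra.
have e1 : 0 < r - cmod (z - a) by lra.
have [y [yz lt]] := local_decrease ef nc fzw e1.
have := zmin y ltac:(rewrite /S /=; have := cmodBD y z a; lra).
lra.
Qed.

(** The difference [f z - f w] is [(z - w) * q a] up to [(z - w) * (q z - q a)] and
    [(w - a) * (q z - q w)], each at most a quarter of the main term in modulus, since [q] is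
    Lipschitz near [a]. The estimate yields injectivity and a Lipschitz inverse at once. *)
Lemma locally_expanding f a : entire f -> derive1 f a != 0 ->
  exists r m, [/\ 0 < r, 0 < m & forall z w, cmod (z - a) < r -> cmod (w - a) < r ->
    m * cmod (z - w) <= cmod (f z - f w)].
Proof.
move=> ef fa0; pose q := quotient_at f a.
have qa : q a = derive1 f a by rewrite /q /quotient_at eqxx.
have eq := @entire_shift R q a (@entire_quotient_at R f a ef).
have [L [L0 lip]] := lipschitz_near0 eq.
have A0 : 0 < cmod (q a) by rewrite qa cmod_gt0.
have L4 : 0 < 4 * L by lra.
exists (Num.min (1 / 2) (cmod (q a) / (4 * L))), (cmod (q a) / 2); split.
- by rewrite lt_min !divr_gt0.
- by lra.
move=> z w; rewrite !lt_min => /andP[z1 z2] /andP[w1 w2].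
move: z2 w2; rewrite !ltr_pdivlMr // => z2 w2.
have aa : cmod (a - a) <= 1 / 2 by rewrite subrr cmod0.
have l1' : cmod (q z - q w) <= L * cmod (z - w).
  by have := lip _ _ (ltW z1) (ltW w1); rewrite !subrK opprB addrA subrK.
have l2 : cmod (q z - q a) <= L * cmod (z - a).
  by have := lip _ _ (ltW z1) aa; rewrite !subrK subrr subr0.
have := cmod_sub ((z - w) * q a) (- ((z - w) * (q z - q a) + (w - a) * (q z - q w))).
have -> : (z - w) * q a - (- ((z - w) * (q z - q a) + (w - a) * (q z - q w))) = f z - f w.
  by rewrite (quotient_atE f a z) (quotient_atE f a w) -/q; ring.
rewrite cmodN !cmodM.
have := cmodD ((z - w) * (q z - q a)) ((w - a) * (q z - q w)); rewrite !cmodM.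
have := cmod_ge0 (z - w); have := cmod_ge0 (w - a).
set zw := cmod (z - w) in l1' *; set wa := cmod (w - a) in w2 *.
set Q := cmod (q a) in z2 w2 *; set q1 := cmod (q z - q a) in l2 *.
set q2 := cmod (q z - q w) in l1' *; set s := cmod (_ + _).
move=> wa0 zw0 hs hf.
have : zw * q1 <= zw * (Q / 4) by rewrite ler_wpM2l //; lra.
have : wa * q2 <= zw * (Q / 4).
  by apply: le_trans (ler_wpM2l wa0 l1') _; nra.
lra.
Qed.

End LocalBehaviour.

(** * Liouville's theorem *)

Section Polynomials.
Variable R : realType.
Local Notation C := R[i].
Implicit Types (f g : C -> C) (c w z a b h : C) (e r : R).

Definition polynomial f := exists p : {poly C}, forall z, f z = p.[z].

(** Induction on the order of growth [d], which the quotient at 0 lowers by one. For [d = 0] the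
    quotient is at most [2 * A / r] on the circle of radius [r], hence 0. *)
Lemma liouville f (A : R) d : entire f -> (forall z, cmod (f z) <= A * (1 + cmod z) ^+ d) ->
  polynomial f.
Proof.
elim: d f A => [|d IH] f A ef fA.
  have fA' z : cmod (f z) <= A by have := fA z; rewrite expr0 mulr1.
  exists (f 0)%:P => w; rewrite hornerC (quotient_atE f 0 w) subr0.
  set q := quotient_at f 0; have eq : entire q by apply: entire_quotient_at.
  suff -> : q w = 0 by rewrite mulr0 addr0.
  apply/eqP; rewrite -cmod_eq0 eq_le cmod_ge0 andbT.
  apply/ler_addgt0Pr => e e0; rewrite add0r.
  pose r := cmod w + (2 * A / e + 1).
  have A0 : 0 <= A := le_trans (cmod_ge0 _) (fA' 0).
  have Ae : 0 <= 2 * A / e by rewrite divr_ge0 ?(ltW e0) //; lra.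
  have r0 : 0 < r by rewrite /r; have := cmod_ge0 w; lra.
  apply: (maximum_principle (a := 0) (r := r) eq); first by rewrite subr0 /r; lra.
  move=> z; rewrite subr0 => zr; rewrite -(ler_pM2r r0) -{1}zr -cmodM mulrC.
  have -> : z * q z = f z - f 0 by rewrite (quotient_atE f 0 z) addKl_sub subr0.
  apply: le_trans (cmodD _ _) _; rewrite cmodN.
  have : 2 * A <= e * r.
    by rewrite (mulrC e) -ler_pdivrMr // /r; have := cmod_ge0 w; lra.
  have := fA' z; have := fA' 0; lra.
set q := quotient_at f 0; have eq : entire q by apply: entire_quotient_at.
have [M [M0 hM]] := bounded_on_disc 1 (entire_continuous eq).
have A0 : 0 <= A.
  have := fA 0; rewrite cmod0 addr0 expr1n mulr1; exact: le_trans (cmod_ge0 _).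
have [p qp] : polynomial q.
  apply: (IH q (M + (cmod (f 0) + 2 * A))) => // z.
  have one_le : 1 <= (1 + cmod z) ^+ d.
    by rewrite exprn_ege1 // lerDl cmod_ge0.
  set S := cmod (f 0) + 2 * A; have S0 : 0 <= S by have := cmod_ge0 (f 0); rewrite /S; lra.
  have [z1|z1] := lerP (cmod z) 1.
    apply: le_trans (hM z z1) _; rewrite -[leLHS]mulr1.
    by apply: ler_pM; [exact: ltW|exact: ler01|rewrite lerDl|].
  apply: (@le_trans _ _ (S * (1 + cmod z) ^+ d)); last first.
    by rewrite ler_wpM2r ?lerDr ?(ltW M0) //; lra.
  have z0 : 0 < cmod z by lra.
  rewrite -(ler_pM2l z0) -cmodM.
  have -> : z * q z = f z - f 0 by rewrite (quotient_atE f 0 z) addKl_sub subr0.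
  apply: le_trans (cmodD _ _) _; rewrite cmodN /S.
  have := fA z; rewrite exprS; have := cmod_ge0 (f 0).
  set E := (1 + cmod z) ^+ d in one_le *; set F := cmod (f 0) => F0 h.
  have : F <= cmod z * E * F by rewrite ler_peMl //; nra.
  have : A * ((1 + cmod z) * E) <= A * (2 * cmod z * E).
    by rewrite ler_wpM2l // ler_wpM2r //; lra.
  lra.
exists ((f 0)%:P + 'X * p) => z.
by rewrite hornerD hornerC hornerM hornerX -qp (quotient_atE f 0 z) subr0.
Qed.

(** * Division by the zeros of an entire function *)

Definition root_product (s : seq C) : {poly C} := \prod_(a <- s) ('X - a%:P).

Lemma root_product_cons a s z : (root_product (a :: s)).[z] = (z - a) * (root_product s).[z].
Proof. by rewrite /root_product big_cons hornerM hornerXsubC. Qed.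

Lemma root_product_nil z : (root_product [::]).[z] = 1.
Proof. by rewrite /root_product big_nil hornerC. Qed.

Lemma root_product_ge s (B r : R) z : (forall a, a \in s -> cmod a <= B) -> 0 <= r ->
  B + r <= cmod z -> r ^+ size s <= cmod (root_product s).[z].
Proof.
move=> sB r0 zr; elim: s sB => [|a s IH] sB; first by rewrite root_product_nil cmod1 expr0.
rewrite root_product_cons cmodM exprS ler_pM ?exprn_ge0 //.
  by have := sB a (mem_head _ _); have := cmod_sub z a; lra.
by apply: IH => b bs; apply: sB; rewrite inE bs orbT.
Qed.

Lemma root_product_le s (B r : R) z : (forall a, a \in s -> cmod a <= B) ->
  cmod z + B <= r -> cmod (root_product s).[z] <= r ^+ size s.
Proof.
move=> sB zr; elim: s sB => [|a s IH] sB; first by rewrite root_product_nil cmod1 expr0.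
rewrite root_product_cons cmodM exprS ler_pM ?cmod_ge0 //.
  by have := sB a (mem_head _ _); have := cmodD z (- a); rewrite cmodN; lra.
by apply: IH => b bs; apply: sB; rewrite inE bs orbT.
Qed.

(* The number of zeros in the disc of radius [B] that can be divided out is
   bounded: with [k] of them, the maximum principle on the disc of radius
   [5 * B] gives [|f| <= M / 2 ^ k] on the disc of radius [B]. *)
Lemma divide_zeros f (B : R) : entire f -> nonconstant f -> 0 < B ->
    (forall z, f z = 0 -> cmod z <= B) ->
  exists s g, [/\ entire g, forall z, g z != 0, forall a, a \in s -> cmod a <= B &
    forall z, f z = (root_product s).[z] * g z].
Proof.
move=> ef nc B0 zB; apply: contrapT => H.
have divide k : exists s g, [/\ size s = k, entire g, forall a, a \in s -> cmod a <= B &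
    forall z, f z = (root_product s).[z] * g z].
  elim: k => [|k [s [g [sk eg sB fE]]]].
    by exists [::], f; split=> // z; rewrite root_product_nil mul1r.
  have [a ga] : exists a, g a = 0.
    apply: contrapT => /forallNP ng; apply: H; exists s, g; split=> // z.
    by apply/eqP; exact: ng.
  exists (a :: s), (quotient_at g a); split.
  - by rewrite /= sk.
  - exact: entire_quotient_at.
  - move=> b; rewrite inE => /orP[/eqP ->|]; last exact: sB.
    by apply: zB; rewrite fE ga mulr0.
  - move=> z; rewrite fE root_product_cons {1}(quotient_atE g a z) ga add0r; ring.
(* The contradiction arises at a point of the disc where [f] does not vanish; if [f 0 = 0], the open
   mapping theorem supplies one. *)
have [z0 [z0B fz0]] : exists z, cmod z <= B /\ f z != 0.
  have [f0|f0] := eqVneq (f 0) 0; last by exists 0; rewrite cmod0 ltW.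
  have [d [d0 hd]] := @open_mapping R f 0 B ef nc B0.
  have cd : cmod ((d / 2)%:C%C : C) = d / 2 by rewrite cmod_real //; lra.
  have [z [zB' fz]] := hd ((d / 2)%:C%C) ltac:(rewrite f0 subr0 cd; lra).
  exists z; rewrite subr0 in zB'; split; first exact: ltW.
  by rewrite fz -cmod_gt0 cd; lra.
have [M [M0 hM]] := bounded_on_disc (5 * B) (entire_continuous ef).
have [n hn] := @geometric_lt R M (cmod (f z0)) 2^-1 ltac:(lra) ltac:(by rewrite cmod_gt0).
have {hn} hn := hn n (leqnn n).
have [s [g [sn eg sB fE]]] := divide n.
have gz0 : cmod (g z0) <= M / (4 * B) ^+ n.
  apply: (maximum_principle (a := 0) (r := 5 * B) eg); first by rewrite subr0; lra.
  move=> z; rewrite subr0 => zr.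
  have p4 : (4 * B) ^+ n <= cmod (root_product s).[z].
    by rewrite -sn; apply: (root_product_ge (B := B)); rewrite ?zr //; lra.
  rewrite ler_pdivlMr ?exprn_gt0 ?mulr_gt0 //.
  apply: le_trans (ler_wpM2l (cmod_ge0 _) p4) _.
  by rewrite mulrC -cmodM -fE hM // zr.
have p2 : cmod (root_product s).[z0] <= (2 * B) ^+ n.
  by rewrite -sn; apply: (root_product_le (B := B)) => //; lra.
have : cmod (f z0) <= (2 * B) ^+ n * (M / (4 * B) ^+ n).
  by rewrite fE cmodM ler_pM ?cmod_ge0.
have -> : (2 * B) ^+ n * (M / (4 * B) ^+ n) = M * 2^-1 ^+ n.
  have -> : 4 * B = 2 * (2 * B) by ring.
  rewrite [(2 * (2 * B)) ^+ n]exprMn exprVn; field.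
  by rewrite !expf_neq0 ?mulf_neq0 ?gt_eqF //= ?pnatr_eq0.
by rewrite leNgt hn.
Qed.

(** With [f = P * g] and [g] free of zeros, [1 / g = P / f] has polynomial growth and so is a
    polynomial. Having no zeros, it is constant, and [f] is a multiple of [P]. *)
Lemma polynomial_of_lower_bound f (B e : R) : entire f -> 0 < e ->
  (forall z, B < cmod z -> e <= cmod (f z)) -> polynomial f.
Proof.
move=> ef e0 fB.
have [[c fc]|nc] := pselect (exists c, forall z, f z = c).
  by exists c%:P => z; rewrite hornerC.
pose B' := `|B| + 1.
have B'0 : 0 < B' by rewrite ltr_wpDl.
have BB' : B < B' by rewrite /B'; have := ler_norm B; lra.
have zB z : f z = 0 -> cmod z <= B'.
  move=> fz; rewrite leNgt; apply/negP => lt; have := fB z (lt_trans BB' lt).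
  by rewrite fz cmod0; lra.
have [s [g [eg g0 sB fE]]] := divide_zeros ef nc B'0 zB.
have eV : entire (fun z => (g z)^-1) := entireV eg g0.
have [M [M0 hM]] := bounded_on_disc B' (entire_continuous eV).
have [p gp] : polynomial (fun z => (g z)^-1).
  apply: (@liouville _ (M + (1 + B') ^+ size s / e) (size s)) => // z.
  have z0 := cmod_ge0 z.
  have one_le : 1 <= (1 + cmod z) ^+ size s by rewrite exprn_ege1 // lerDl.
  have K0 : 0 <= (1 + B') ^+ size s / e by rewrite divr_ge0 ?(ltW e0) // exprn_ge0 //; lra.
  have [z1|z1] := lerP (cmod z) B'.
    apply: le_trans (hM z z1) _; rewrite -[leLHS]mulr1.
    by apply: ler_pM; [exact: ltW|exact: ler01|rewrite lerDl|].
  have ps : cmod (root_product s).[z] <= ((1 + B') * (1 + cmod z)) ^+ size s.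
    by apply: (root_product_le (B := B')) => //; nra.
  have ef' : e <= cmod (f z) by apply: fB; lra.
  have -> : (g z)^-1 = (root_product s).[z] / f z.
    have := ef'; rewrite fE cmodM => ef2.
    have p0 : (root_product s).[z] != 0.
      apply/eqP => h; move: ef2; rewrite h cmod0 mul0r; lra.
    by rewrite invfM mulrA mulfV // mul1r.
  rewrite cmodM cmodV; apply: (@le_trans _ _ (((1 + B') * (1 + cmod z)) ^+ size s / e)).
    apply: ler_pM; rewrite ?invr_ge0 ?cmod_ge0 //.
    by rewrite lef_pV2 ?posrE //; lra.
  rewrite exprMn mulrAC ler_wpM2r // ?lerDr ?ltW //; lra.
have pg z : p.[z] * g z = 1 by rewrite -gp mulVf.
have sp : size p == 1%N.
  apply/negPn/negP => /closed_rootP[x /eqP px].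
  by have := pg x; rewrite px mul0r => /eqP; rewrite eq_sym oner_eq0.
have /size_poly1P[c c0 pc] := sp.
exists (root_product s * c^-1%:P) => z.
rewrite hornerM hornerC fE; congr (_ * _).
by have := pg z; rewrite pc hornerC => h; rewrite -[LHS](mulKf c0) h mulr1.
Qed.

End Polynomials.

(** * Domains surrounded by large values *)

Section FastEscaping.
Variable R : realType.
Local Notation C := R[i].
Implicit Types (f g : C -> C) (c w z a b h : C) (e r : R) (D E : set C).

Lemma bounded_set_cmod E : bounded_set E -> exists B : R, forall z, E z -> cmod z <= B.
Proof.
move=> [M [Mreal hM]]; exists (complex.Re M + 1) => z Ez.
have ME : M = (complex.Re M)%:C%C.
  by apply/eqP; rewrite eq_complex /= eqxx /=; move: Mreal;
    rewrite realE !lecE /= => /orP[|] /andP[]; rewrite // eq_sym.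
have := hM (complex.Re M + 1)%:C%C; rewrite {1}ME ltcR ltrDl ltr01 => /(_ isT z Ez) /=.
by rewrite cmodE lecR.
Qed.

Lemma max_modulus_ge f r z : entire f -> 0 <= r -> cmod z <= r -> cmod (f z) <= max_modulus f r.
Proof.
move=> ef r0 zr; have [M [M0 hM]] := bounded_on_disc r (entire_continuous ef).
apply: (maximum_principle (a := 0) (r := r) ef); first by rewrite subr0.
move=> y; rewrite subr0 => yr; apply: ub_le_sup; last by exists y.
by exists M => _ [x /= xr <-]; apply: hM; rewrite xr.
Qed.

Lemma max_modulus_gt f r (L : R) : entire f -> 0 <= r -> L < max_modulus f r ->
  exists z, cmod z = r /\ L < cmod (f z).
Proof.
move=> ef r0 Lr; have [M [M0 hM]] := bounded_on_disc r (entire_continuous ef).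
have e0 : 0 < max_modulus f r - L by lra.
have hs : has_sup [set cmod (f z) | z in [set z : C | cmod z = r]].
  split; first by exists (cmod (f r%:C%C)); exists r%:C%C => //; exact: cmod_real.
  by exists M => _ [x /= xr <-]; apply: hM; rewrite xr.
have [_ [z /= zr <-]] := sup_adherent e0 hs.
by rewrite -/(max_modulus f r) subKr => lt; exists z.
Qed.

(** Otherwise the iterates increase to a finite [L]. As [M(L, f) > L], some [z] with [cmod z = L]
    has [cmod (f z) > L]. Scaled down to a radius [u m] close to [L] it keeps this property,
    although [M(u m, f) = u m.+1 <= L]. *)
Lemma iter_max_modulus_unbounded f r (K : R) : entire f -> 0 < r ->
    (forall s, r <= s -> s < max_modulus f s) ->
  exists m, K < iter m (max_modulus f) r.
Proof.
move=> ef r0 fM; apply: contrapT => /forallNP H.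
pose u m := iter m (max_modulus f) r.
have uK m : u m <= K by rewrite leNgt; apply/negP; exact: H.
have ur m : r <= u m.
  by elim: m => [|m IH] //=; apply: le_trans IH (ltW (fM _ IH)).
have uS m : u m.+1 = max_modulus f (u m) by [].
clearbody u.
have hs : has_sup (range u) by split; [exists (u 0%N), 0%N|exists K => _ [m _ <-]].
set L := sup (range u).
have uL m : u m <= L by apply: ub_le_sup; [exact: hs.2|exists m].
have rL : r <= L := le_trans (ur 0%N) (uL 0%N).
have L0 : 0 < L := lt_le_trans r0 rL.
have [z [zL Lz]] := max_modulus_gt ef (ltW L0) (fM _ rL).
have e0 : 0 < cmod (f z) - L by lra.
have [d [d0 hd]] := (continuous_cmod f z).1 (@entire_continuous _ _ ef z) _ e0.
have [_ [m _ <-] lt] := sup_adherent d0 hs; rewrite -/L in lt.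
pose t := u m / L.
have t0 : 0 <= t by rewrite divr_ge0 // ?(ltW L0) //; have := ur m; lra.
have tz : cmod (t%:C%C * z) = u m by rewrite cmodM cmod_real // zL mulfVK // gt_eqF.
have t1 : t <= 1 by rewrite ler_pdivrMr // mul1r.
have close : cmod (t%:C%C * z - z) < d.
  have -> : t%:C%C * z - z = - ((1 - t)%:C%C * z) by rewrite rmorphB rmorph1; ring.
  rewrite cmodN cmodM cmod_real ?subr_ge0 // zL mulrBl mul1r mulfVK ?gt_eqF //.
  by rewrite ltrBlDr -ltrBlDl.
have h1 := hd _ close; have h2 := cmod_sub (f z) (f (t%:C%C * z)).
rewrite (cmodB (f z)) in h2.
have h3 : cmod (f (t%:C%C * z)) <= u m.+1.
  by rewrite uS; apply: max_modulus_ge => //; rewrite ?tz //; have := ur m; lra.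
have := uL m.+1; lra.
Qed.

Lemma open_image_iter f m D : entire f -> nonconstant f -> open D -> open (iter m f @` D).
Proof.
move=> ef nc oD; elim: m => [|m /open_cmod IH]; first by rewrite /= image_id.
apply/open_cmod => _ [z Dz <-] /=.
have [e [e0 he]] := IH (iter m f z) (imageP _ Dz).
have [d [d0 hd]] := open_mapping (iter m f z) ef nc e0.
exists d; split=> // y /hd[x [/he[z' Dz' <-] <-]].
by exists z'.
Qed.

Lemma continuous_iter f m : continuous f -> continuous (iter m f).
Proof.
move=> cf; elim: m => [|m IH] z; first exact: cvg_id.
by apply: (@continuous_comp _ _ _ (iter m f) f); [exact: IH|exact: cf].
Qed.

Lemma segment_in_disc a b r z : cmod a < r -> cmod b < r -> segment a b z -> cmod z < r.
Proof.
move=> ar br zs; apply: (@le_lt_trans _ _ (Num.max (cmod a) (cmod b))); last first.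
  by rewrite gt_max ar br.
rewrite -[z]subr0; apply: segment_cmod_le zs; rewrite subr0 le_max lexx ?orbT //.
Qed.

(** Collects what the conclusions use of the web. As [D] is open, its frontier is [closure D]
    without [D]. *)
Definition surrounded f (rho : R) D :=
  [/\ open D, exists B, forall z, D z -> cmod z <= B, forall z, cmod z <= rho -> D z &
      forall z, closure D z -> ~ D z -> rho <= cmod (f z)].

Lemma spiders_web_surrounded f r (rho : R) : entire f -> nonconstant f -> 0 < r ->
    (forall s, r <= s -> s < max_modulus f s) ->
    spiders_web (fast_escaping_level f r) ->
  exists D, surrounded f rho D.
Proof.
move=> ef nc r0 fM [_ [G [Gd _ GA Gcover]]].
pose u m := iter m (max_modulus f) r.
have ur m : r <= u m.
  by elim: m => [|m IH] //=; apply: le_trans IH (ltW (fM _ IH)).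
have u_incr m : u m < u m.+1 by apply: fM.
have uS m : u m.+1 = max_modulus f (u m) by [].
have u0 : u 0%N = r by [].
have [m' hm'] := iter_max_modulus_unbounded rho ef r0 fM.
(* A successor, since [fast_escaping_level] speaks of positive iterates. *)
pose m := m'.+1; have um : rho < u m := lt_trans hm' (u_incr m').
have [n _ Gn0] : (\bigcup_n G n) 0 by rewrite Gcover.
have [/bounded_set_cmod[B GB] [[_ oG _] _]] := Gd n.
have cfm : continuous (iter m f) by apply: continuous_iter; apply: entire_continuous.
pose D := iter m f @` G n; exists D.
have oD : open D by apply: open_image_iter.
(* As [G n] is bounded, preimages of points of [D] tending to [w] cluster at some [p] with
   [iter m f p = w]; since [w] is not in [D], [p] is not in [G n] and lies on its boundary. *)
have frontier w : closure D w -> ~ D w -> u m <= cmod w /\ u m.+1 <= cmod (f w).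
  move=> /closure_cmod cl nDw.
  have H k : exists y, G n y /\ cmod (iter m f y - w) < k.+1%:R^-1.
    have [_ [[y Gy <-] lt]] := cl k.+1%:R^-1 ltac:(by rewrite invr_gt0).
    by exists y.
  have [y hy] := choice H.
  have [p hp] := cluster_point (fun k => GB _ (hy k).1).
  have clp : closure (G n) p by apply: closure_cluster hp => k; case: (hy k).
  have fp : iter m f p = w.
    apply/eqP; rewrite -subr_eq0 -cmod_eq0 eq_le cmod_ge0 andbT.
    apply/ler_addgt0Pr => e e0; rewrite add0r; have e2 : 0 < e / 2 by lra.
    have [d [d0 hd]] := (continuous_cmod _ _).1 (cfm p) _ e2.
    have [N hN] := natSinv_lt e2; have [k [Nk /hd lt]] := hp d d0 N.
    have lt2 := lt_trans (hy k).2 (hN k Nk).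
    have := cmodBD (iter m f p) (iter m f (y k)) w.
    by rewrite (cmodB (iter m f p) (iter m f (y k))); lra.
  have Ap : fast_escaping_level f r p.
    apply: (GA n); split=> // ip; apply: nDw; rewrite -fp.
    exact/imageP/(interior_subset ip).
  by split; rewrite -fp; [exact: (Ap m)|exact: (Ap m.+1)].
clearbody u.
split=> //.
- have [M [M0 hM]] := bounded_on_disc B cfm.
  by exists M => _ [z Gz <-]; apply: hM; apply: GB.
- have f0 k : cmod (iter k f 0) <= u k.
    elim: k => [|k IH]; first by rewrite (_ : iter 0 f 0 = 0) // cmod0 u0; apply: ltW.
    by rewrite uS iterS; apply: max_modulus_ge => //; have := ur k; lra.
  have um0 : 0 < u m by have := ur m; lra.
  (* The bound [cmod (iter m f 0) <= u m] may be an equality. As [D] is open, a slight shrinking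
     towards 0 stays in [D] and makes it strict, so that the segment to [z] avoids the frontier. *)
  have [w [Dw wu]] : exists w, D w /\ cmod w < u m.
    have Dw0 : D (iter m f 0) by exact: imageP.
    have [w00|w0] := eqVneq (iter m f 0) 0.
      by exists 0; rewrite cmod0; split=> //; rewrite -w00.
    have {}f0 := f0 m; set w := iter m f 0 in f0 w0 Dw0.
    have cw : 0 < cmod w by rewrite cmod_gt0.
    have [e [e0 he]] := (open_cmod D).1 oD _ Dw0.
    pose t := Num.min (1 / 2) (e / (2 * cmod w)).
    have t0 : 0 < t by rewrite lt_min !divr_gt0 // mulr_gt0.
    have t1 : t <= 1 / 2 by rewrite ge_min lexx.
    have : t <= e / (2 * cmod w) by rewrite ge_min lexx orbT.
    rewrite ler_pdivlMr ?mulr_gt0 // => t2.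
    exists ((1 - t)%:C%C * w); split.
      apply: he; have -> : (1 - t)%:C%C * w - w = - (t%:C%C * w).
        by rewrite rmorphB rmorph1; ring.
      by rewrite cmodN cmodM cmod_real ?(ltW t0) //; nra.
    by rewrite cmodM cmod_real; [nra|lra].
  move=> z zr; apply: contrapT => nDz.
  have zu : cmod z < u m by lra.
  have [y [ys cly nDy]] := connected_meets_frontier (@segment_connectedC R w z) oD
    (segment_left w z) Dw (segment_right w z) nDz.
  have := segment_in_disc wu zu ys; have [] := frontier y cly nDy; lra.
- by move=> w cl nD; have [_] := frontier w cl nD; have := u_incr m; lra.
Qed.

(** * Paths to infinity and bounded fibres *)

Lemma no_bounded_path f : (forall rho, exists D, surrounded f rho D) ->
  ~ exists gamma : R -> C, path_to_infinity gamma /\ bounded_on_path f gamma.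
Proof.
move=> sur [gamma [[cgamma gamma_oo] /bounded_set_cmod[K hK]]].
have [D [oD [B DB] Ddisc Dfr]] := sur (Num.max (K + 1) (cmod (gamma 0))).
have cE : connected (gamma @` `[0, +oo[).
  apply: connected_continuous_connected cgamma.
  by apply/connected_intervalP; exact: interval_is_interval.
have [t [t0 tB]] : exists t, 0 <= t /\ B < cmod (gamma t).
  move/cvgryPgt : gamma_oo => /(_ B)[x [_ hx]].
  exists (Num.max 0 (x + 1)); split; first by rewrite le_max lexx.
  by apply: hx; rewrite lt_max ltrDl ltr01 orbT.
have E0 : (gamma @` `[0, +oo[) (gamma 0) by exists 0; rewrite //= in_itv /= lexx.
have Et : (gamma @` `[0, +oo[) (gamma t) by exists t; rewrite //= in_itv /= t0.
have D0 : D (gamma 0) by apply: Ddisc; rewrite le_max lexx orbT.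
have nDt : ~ D (gamma t) by move=> /DB; lra.
have [y [Ey cly nDy]] := connected_meets_frontier cE oD E0 D0 Et nDt.
have := Dfr y cly nDy; rewrite ge_max => /andP[+ _].
have := hK (f y) (imageP _ Ey); lra.
Qed.

Lemma polynomial_of_bounded_fiber f (al : C) (B : R) : entire f -> nonconstant f ->
    (forall rho, exists D, surrounded f rho D) ->
    (forall z, f z = al -> cmod z <= B) ->
  polynomial f.
Proof.
move=> ef nc sur zB; pose F z := f z - al.
have eF : entire F := entireB ef (@entire_cst R al).
have ncF : nonconstant F.
  by move=> [c Fc]; apply: nc; exists (c + al) => z; rewrite -(Fc z) subrK.
have F1 z (x : R) : cmod al + 1 <= x -> x <= cmod (f z) -> 1 <= cmod (F z).
  by move=> h1 h2; have := cmod_sub (f z) al; rewrite /F; lra.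
(* The radius [B] puts the whole fibre of [al] into [D1], and [cmod al + 1] makes [cmod (F z) >= 1]
   on the frontier of [D1]. *)
have [D1 [oD1 [B1 D1B] D1disc D1fr]] := sur (Num.max B (cmod al + 1)).
suff lb z : ~ D1 z -> 1 <= cmod (F z).
  have [p Fp] : polynomial F.
    apply: (@polynomial_of_lower_bound _ F B1 1 eF ltr01) => z lt.
    by apply: lb => /D1B; lra.
  by exists (p + al%:P) => z; rewrite hornerD hornerC -Fp subrK.
move=> nD1; rewrite leNgt; apply/negP => Flt.
have [D2 [oD2 [B2 D2B] D2disc D2fr]] := sur (Num.max (Num.max B1 (cmod z)) (cmod al + 1)).
pose S := closure D2 `&` ~` D1.
have clS : closed S by apply: closedI; [exact: closed_closure|exact: open_closedC].
have SB y : S y -> cmod y <= B2.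
  move=> [/closure_cmod cl _]; apply/ler_addgt0Pr => e e0.
  have [x [/D2B xB]] := cl e e0; have := cmod_sub y x; rewrite cmodB; lra.
have D2z : D2 z by apply: D2disc; rewrite !le_max lexx !orbT.
have Sz : S z by split=> //; exact: subset_closure.
have [y [[cly nD1y] ymin]] := cmod_attains_min (entire_continuous eF) clS SB (ex_intro _ z Sz).
have Fy : cmod (F y) < 1 by have := ymin z Sz; lra.
have D2y : D2 y.
  apply: contrapT => nD2y; have := D2fr y cly nD2y; rewrite ge_max => /andP[_ h].
  by have := F1 y _ (lexx _) h; lra.
have ncl1 : ~ closure D1 y.
  move=> cl1y; have := D1fr y cl1y nD1y; rewrite ge_max => /andP[_ h].
  by have := F1 y _ (lexx _) h; lra.
have oO : open (D2 `&` ~` closure D1).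
  by apply: openI => //; exact: closed_openC (@closed_closure _ _).
have [e [e0 he]] := (open_cmod _).1 oO y (conj D2y ncl1).
have Fy0 : F y != 0.
  apply/eqP => /eqP; rewrite subr_eq0 => /eqP /zB yB; apply: nD1y; apply: D1disc.
  by rewrite le_max yB.
have [x [xy]] := local_decrease eF ncF Fy0 e0.
rewrite !subr0 => lt; have [D2x ncl1x] := he x xy.
have := ymin x; have Sx : S x by split; [exact: subset_closure|move=> /subset_closure].
by move=> /(_ Sx); lra.
Qed.

Lemma finite_set_bounded E : finite_set E -> exists B : R, forall z, E z -> cmod z <= B.
Proof.
move=> /finite_seqP[s ->]; elim: s => [|a s [B hB]]; first by exists 0.
exists (Num.max (cmod a) B) => z /=; rewrite inE => /orP[/eqP ->|zs].
  by rewrite le_max lexx.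
by rewrite le_max (hB z zs) orbT.
Qed.

End FastEscaping.

(** * Connected sublevel sets *)

Section SublevelSets.
Variable R : realType.
Local Notation C := R[i].
Implicit Types (f g : C -> C) (c w z a b h : C) (e r t : R) (D E : set C).

(** The margin [s < t] is uniform on [E]: a link at level [t] is also one at some lower level, on
    which [linked_sublevel] relies. *)
Definition linked f t z w := exists E s,
  [/\ connected E, E z, E w, s < t & forall y, E y -> cmod (f y) <= s].

Lemma linked_refl f t z : cmod (f z) < t -> linked f t z z.
Proof. by move=> ft; exists [set z], (cmod (f z)); split=> // [|y ->]; first exact: connected1. Qed.

Lemma linked_sym f t z w : linked f t z w -> linked f t w z.
Proof. by move=> [E [s [? ? ? ? ?]]]; exists E, s. Qed.

Lemma linked_trans f t y z w : linked f t y z -> linked f t z w -> linked f t y w.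
Proof.
move=> [E [s [cE Ey Ez st fE]]] [F [u [cF Fz Fw ut fF]]].
exists (E `|` F), (Num.max s u); split.
- by apply: connectedU => //; exists z.
- by left.
- by right.
- by rewrite gt_max st.
- by move=> x [/fE|/fF] h; rewrite le_max h ?orbT.
Qed.

Lemma linked_le f t u z w : t <= u -> linked f t z w -> linked f u z w.
Proof.
by move=> tu [E [s [? ? ? st ?]]]; exists E, s; split=> //; apply: lt_le_trans tu.
Qed.

Lemma linked_near f t z : continuous f -> cmod (f z) < t ->
  exists e, 0 < e /\ forall y, cmod (y - z) < e -> linked f t z y.
Proof.
move=> cf ft; have e0 : 0 < (t - cmod (f z)) / 2 by lra.
have [d [d0 hd]] := (continuous_cmod f z).1 (cf z) _ e0.
exists d; split=> // y yd; exists (segment z y), ((t + cmod (f z)) / 2); split.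
- exact: segment_connectedC.
- exact: segment_left.
- exact: segment_right.
- lra.
- move=> x xs; have xz : cmod (x - z) < d.
    apply: le_lt_trans yd; apply: segment_cmod_le xs => //.
    by rewrite subrr cmod0 cmod_ge0.
  by have := hd _ xz; have := cmod_sub (f x) (f z); lra.
Qed.

(* Near a noncritical point [f] is a homeomorphism onto a disc, whose
   intersection with [|w| < t] is convex. *)
Lemma linked_near_regular f t a : entire f -> nonconstant f -> derive1 f a != 0 ->
  exists e, 0 < e /\ forall z w, cmod (z - a) < e -> cmod (w - a) < e ->
    cmod (f z) < t -> cmod (f w) < t -> linked f t z w.
Proof.
move=> ef nc fa0; have [r [m [r0 m0 expand]]] := locally_expanding ef fa0.
have [d [d0 hd]] := open_mapping a ef nc r0.
have [e1 [e10 he]] := (continuous_cmod f a).1 (@entire_continuous _ _ ef a) _ d0.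
exists (Num.min e1 r); split; first by rewrite lt_min e10.
move=> z w; rewrite !lt_min => /andP[z1 z2] /andP[w1 w2] fzt fwt.
(* Outside the disc about [f a] the condition is vacuous and 0 is a default. *)
have inverse v : exists x, cmod (v - f a) < d -> cmod (x - a) < r /\ f x = v.
  by case: (pselect (cmod (v - f a) < d)) => [/hd[x hx]|nv]; [exists x|exists 0].
have [inv hinv] := choice inverse.
have zd := he _ z1; have wd := he _ w1.
pose v (s : R) : C := f z + s%:C%C * (f w - f z).
have seg s : 0 <= s <= 1 -> segment (f z) (f w) (v s) by exists s => //=; rewrite in_itv.
have vd s : 0 <= s <= 1 -> cmod (v s - f a) < d.
  move=> s01; apply: (@le_lt_trans _ _ (Num.max (cmod (f z - f a)) (cmod (f w - f a)))).
    by apply: segment_cmod_le (seg s s01); rewrite le_max lexx ?orbT.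
  by rewrite gt_max zd wd.
have inv_inj x y : cmod (x - a) < r -> cmod (y - a) < r -> f x = f y -> x = y.
  move=> xr yr fxy; have := expand _ _ xr yr; rewrite fxy subrr cmod0 => h.
  by apply/eqP; rewrite -subr_eq0 -cmod_eq0 eq_le cmod_ge0 andbT -(pmulr_rle0 _ m0).
have i0 : 0 <= (0 : R) <= 1 by rewrite lexx ler01.
have i1 : 0 <= (1 : R) <= 1 by rewrite lexx ler01.
have v0 : v 0 = f z by rewrite /v mul0r addr0.
have v1 : v 1 = f w by rewrite /v mul1r addrC subrK.
exists [set inv (v s) | s in `[0, 1]], (Num.max (cmod (f z)) (cmod (f w))); split.
(* The expansion estimate makes the inverse Lipschitz with constant [1 / m], so the lifted segment
   is connected. *)
- apply: (@connected_lipschitz_image _ _ (cmod (f w - f z) / m)) => s s' s01 s'01.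
  have [h1 h2] := hinv _ (vd s s01); have [h3 h4] := hinv _ (vd s' s'01).
  rewrite mulrAC ler_pdivlMr // mulrC; apply: le_trans (expand _ _ h1 h3) _.
  rewrite h2 h4 /v opprD addrACA subrr add0r -mulrBl -rmorphB cmodM cmodR.
  by rewrite mulrC.
- exists 0; first by rewrite /= in_itv /= lexx ler01.
  have [h1 h2] := hinv _ (vd 0 i0); apply: inv_inj => //; last by rewrite h2.
- exists 1; first by rewrite /= in_itv /= lexx ler01.
  have [h1 h2] := hinv _ (vd 1 i1); apply: inv_inj => //; last by rewrite h2.
- by rewrite gt_max fzt.
- move=> y [s /= s01 <-]; rewrite in_itv /= in s01.
  have [_ ->] := hinv _ (vd s s01).
  by rewrite -[v s]subr0; apply: segment_cmod_le (seg s s01); rewrite subr0 le_max lexx ?orbT.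
Qed.

Lemma connected_in_surrounded f (rho : R) D E z : surrounded f rho D -> connected E ->
  E z -> cmod z <= rho -> (forall y, E y -> cmod (f y) < rho) -> forall y, E y -> D y.
Proof.
move=> [oD _ Ddisc Dfr] cE Ez zr fE y Ey; apply: contrapT => nDy.
have [x [Ex clx nDx]] := connected_meets_frontier cE oD Ez (Ddisc _ zr) Ey nDy.
by have := Dfr x clx nDx; have := fE x Ex; lra.
Qed.

(** The closure [X] of the class [W] of [z1] is open relative to [|f| <= t], at level [t] by
    [linked_near_regular], and does not contain [z2]. Links at levels above [t] must leave each
    small neighbourhood [O e] of [X]. In a surrounding domain the exit points cluster, for fixed [e]
    as the level tends to [t] and then as [e] tends to 0, at a point of [X] that is approached by
    points outside [X] with [|f| <= t]: a contradiction. *)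
Lemma linked_limit f t z1 z2 : entire f -> nonconstant f ->
    (forall rho, exists D, surrounded f rho D) -> 0 < t ->
    (forall z, cmod (f z) = t -> derive1 f z != 0) ->
    cmod (f z1) < t -> cmod (f z2) < t ->
    (forall u, t < u -> linked f u z1 z2) ->
  linked f t z1 z2.
Proof.
move=> ef nc sur t0 reg f1 f2 link; apply: contrapT => nlink.
have cf := entire_continuous ef.
pose W := [set z | linked f t z1 z]; pose X := closure W.
have W1 : W z1 by exact: linked_refl.
have WX : W `<=` X := @subset_closure _ W.
have XP z : X z <-> forall e, 0 < e -> exists y, W y /\ cmod (y - z) < e := closure_cmod W z.
have clX : closed X := @closed_closure _ W.
clearbody X.
have Wlt z : W z -> cmod (f z) < t.
  by move=> [E [s [_ _ Ez st fE]]]; apply: le_lt_trans st; exact: fE.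
have Xle z : X z -> cmod (f z) <= t.
  move=> /XP cl; apply/ler_addgt0Pr => e e0.
  have [d [d0 hd]] := (continuous_cmod f z).1 (cf z) _ e0.
  have [y [/Wlt fy /hd yz]] := cl d d0.
  by have := cmod_sub (f z) (f y); rewrite cmodB; lra.
have Xopen a : X a -> exists e, 0 < e /\
    forall z, cmod (z - a) < e -> cmod (f z) <= t -> X z.
  move=> Xa; have /XP cl := Xa.
  have := Xle a Xa; rewrite le_eqVlt => /orP[/eqP fa|fa]; last first.
    have [e [e0 he]] := linked_near cf fa.
    exists e; split; first exact: e0.
    move=> z za _; have az := he z za; apply: WX.
    have [y [Wy /he ay]] := cl e e0.
    exact: linked_trans (linked_trans Wy (linked_sym ay)) az.
  have [e [e0 he]] := linked_near_regular t ef nc (reg a fa).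
  exists (e / 2); split; first by lra.
  move=> z za fzt; apply/XP => d d0.
  (* A point with [|f| = t] is a limit of points with [|f| < t], by [local_decrease] with target
     value 0; this is where [0 < t] enters. *)
  have [x [xz fx]] : exists x, cmod (x - z) < Num.min d (e / 2) /\ cmod (f x) < t.
    have m0 : 0 < Num.min d (e / 2) by rewrite lt_min d0; lra.
    move: fzt; rewrite le_eqVlt => /orP[/eqP fz|fz]; last first.
      by exists z; rewrite subrr cmod0.
    have fz0 : f z != 0 by rewrite -cmod_gt0 fz.
    have [x [xz]] := local_decrease ef nc fz0 m0; rewrite !subr0 fz => fx.
    by exists x.
  move: xz; rewrite lt_min => /andP[xd xe]; exists x; split=> //.
  have [y [Wy ya]] := cl e e0.
  have fy := Wlt y Wy; have xa : cmod (x - a) < e by have := cmodBD x z a; lra.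
  exact: linked_trans Wy (he _ _ ya xa fy fx).
(* The links used below have levels at most [t + 1], so that all of them stay in this one bounded
   domain. *)
have [D sD] := sur (Num.max (t + 1) (cmod z1)).
have [_ [B DB] _ _] := sD.
have inD E u : u <= t + 1 -> connected E -> E z1 -> (forall y, E y -> cmod (f y) < u) ->
    forall y, E y -> cmod y <= B.
  move=> ut cE E1 fE y Ey; apply: DB; apply: (connected_in_surrounded sD cE E1) => //.
    by rewrite le_max lexx orbT.
  by move=> x /fE fx; rewrite lt_max (lt_le_trans fx ut).
have nX2 : ~ X z2.
  move=> /XP cl; have [e [e0 he]] := linked_near cf f2.
  have [y [Wy /he ay]] := cl e e0.
  exact/nlink/(linked_trans Wy (linked_sym ay)).
have [d [d0 hd]] : exists d, 0 < d /\ forall y, X y -> d <= cmod (y - z2).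
  have oX : open (~` X) by exact: closed_openC.
  have [d [d0 hd]] := (open_cmod (~` X)).1 oX z2 nX2.
  exists d; split; first exact: d0.
  move=> y Xy.
  by rewrite leNgt; apply/negP => /hd.
pose O (e : R) := [set z | exists a, X a /\ cmod (z - a) < e].
have oO e : open (O e).
  apply/open_cmod => z [a [Xa za]]; exists (e - cmod (z - a)); split; first by lra.
  by move=> y yz; exists a; split=> //; have := cmodBD y z a; lra.
have escape (e : R) : exists y, 0 < e -> e <= d ->
    [/\ cmod y <= B, cmod (f y) <= t, ~ O e y & exists a, X a /\ cmod (y - a) < 2 * e].
  case: (pselect (0 < e)) => [e0|ne]; last by exists 0 => e0; case: ne.
  case: (pselect (e <= d)) => [ed|ned]; last by exists 0 => _ ed; case: ned.
  have step k : exists y, [/\ cmod y <= B, cmod (f y) < t + k.+1%:R^-1,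
      closure (O e) y & ~ O e y].
    have k0 : 0 < k.+1%:R^-1 :> R by rewrite invr_gt0.
    have k1 : k.+1%:R^-1 <= 1 :> R by rewrite invf_le1 // ler1n.
    have [E [s [cE E1 E2 st fE]]] := link (t + k.+1%:R^-1) ltac:(by rewrite ltrDl).
    have fE' y : E y -> cmod (f y) < t + k.+1%:R^-1.
      by move=> /fE h; apply: le_lt_trans st.
    have O1 : O e z1 by exists z1; rewrite subrr cmod0; split=> //; exact: WX.
    have nO2 : ~ O e z2 by move=> [a [/hd h]]; rewrite cmodB; lra.
    have [y [Ey cly nOy]] := connected_meets_frontier cE (oO e) E1 O1 E2 nO2.
    exists y; split=> //; last exact: fE'.
    by apply: (inD E (t + k.+1%:R^-1)) => //; rewrite lerD2l.
  have [y hy] := choice step.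
  have yB k : cmod (y k) <= B by case: (hy k).
  have [p hp] := cluster_point yB; exists p => _ _; split.
  - apply/ler_addgt0Pr => x x0; have [k [_ kp]] := hp x x0 0%N.
    by have := yB k; have := cmod_sub p (y k); rewrite cmodB; lra.
  - apply/ler_addgt0Pr => x x0; have x2 : 0 < x / 2 by lra.
    have [b [b0 hb]] := (continuous_cmod f p).1 (cf p) _ x2.
    have [N hN] := natSinv_lt x2; have [k [Nk /hb kp]] := hp b b0 N.
    have kx : t + k.+1%:R^-1 < t + x / 2 by rewrite ltrD2l; exact: hN.
    have [_ fy _ _] := hy k; have fy' := lt_trans fy kx.
    by have := cmod_sub (f p) (f (y k)); rewrite cmodB; lra.
  - have clC : closed (~` O e) by exact: open_closedC.
    by apply: clC; apply: closure_cluster hp => k; case: (hy k).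
  - have : closure (O e) p.
      apply: (@closed_closure _ (O e)).
      by apply: closure_cluster hp => k; case: (hy k).
    move=> /closure_cmod /(_ e e0)[x [[a [Xa xa]] xp]]; exists a; split=> //.
    by have := cmodBD p x a; rewrite (cmodB p x); lra.
have [y hy] := choice escape.
pose e k := d * k.+1%:R^-1.
have e0 k : 0 < e k by rewrite mulr_gt0 // invr_gt0.
have ed k : e k <= d by rewrite ger_pMr // invf_le1 // ler1n.
have yB k : cmod (y (e k)) <= B by case: (hy _ (e0 k) (ed k)).
have [p hp] := cluster_point yB.
have near_X k : exists a, X a /\ cmod (y (e k) - a) < 2 * e k.
  by case: (hy _ (e0 k) (ed k)).
have [a ha] := choice near_X.
have e_small x : 0 < x -> exists n, forall k, (n <= k)%N -> e k < x.
  move=> x0; have [N hN] := natSinv_lt (divr_gt0 x0 d0).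
  by exists N => k /hN; rewrite ltr_pdivlMr // mulrC.
have Xp : X p.
  apply: clX; apply: (closure_cluster (u := a)) => [k|x x0 n].
    by case: (ha k).
  have x3 : 0 < x / 3 by lra.
  have [N hN] := e_small _ x3; have [k [Nk kp]] := hp _ x3 (maxn n N).
  move: Nk; rewrite geq_max => /andP[nk /hN ek]; exists k; split=> //.
  have [_ ak] := ha k.
  by have := cmodBD (a k) (y (e k)) p; rewrite (cmodB (a k) (y (e k))); lra.
have [x [x0 hx]] := Xopen p Xp.
have [k [_ /hx kX]] := hp x x0 0%N.
have [_ fk nO _] := hy _ (e0 k) (ed k).
by apply: nO; exists (y (e k)); rewrite subrr cmod0; split=> //; exact: kX.
Qed.

(** By [linked_limit] the infimum of the levels that join the points is attained; if it were above
    [K], the margin in [linked] would allow a lower level. *)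
Lemma linked_sublevel f (K : R) z1 z2 : entire f -> nonconstant f ->
    (forall rho, exists D, surrounded f rho D) -> 0 < K ->
    (forall z, K <= cmod (f z) -> derive1 f z != 0) ->
    cmod (f z1) < K -> cmod (f z2) < K ->
  linked f K z1 z2.
Proof.
move=> ef nc sur K0 reg f1 f2.
pose P := [set t | K <= t /\ linked f t z1 z2].
have [M [M0 hM]] := bounded_on_disc (cmod z1 + cmod z2) (entire_continuous ef).
have hP : has_inf P.
  split; last by exists K => t [].
  exists (Num.max K (M + 1)); split; first by rewrite le_max lexx.
  exists (segment z1 z2), M; split.
  - exact: segment_connectedC.
  - exact: segment_left.
  - exact: segment_right.
  - by rewrite lt_max ltrDl ltr01 orbT.
  - move=> y ys; apply: hM; rewrite -[y]subr0; apply: segment_cmod_le ys; rewrite subr0.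
      by rewrite lerDl cmod_ge0.
    by rewrite lerDr cmod_ge0.
set t := inf P.
have Kt : K <= t by apply: lb_le_inf; [exact: hP.1|move=> u []].
have link u : t < u -> linked f u z1 z2.
  move=> tu; have [p [_ hp] pu] := inf_adherent (ltac:(lra) : 0 < u - t) hP.
  by apply: linked_le hp; rewrite -/t addrC subrK in pu; exact: ltW.
have lt : linked f t z1 z2.
  apply: linked_limit => //; [lra| |lra|lra].
  by move=> z fz; apply: reg; rewrite fz.
move: Kt; rewrite le_eqVlt => /orP[/eqP -> //|Kt].
have [E [s [cE E1 E2 st fE]]] := lt.
have m : Num.max K ((s + t) / 2) < t by rewrite gt_max Kt; lra.
suff : t <= Num.max K ((s + t) / 2) by lra.
apply: ge_inf; first exact: hP.2.
split; first by rewrite le_max lexx.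
exists E, s; split=> //; rewrite lt_max; apply/orP; right; lra.
Qed.

Lemma polynomial_of_bounded_critical_values f (K : R) : entire f -> nonconstant f ->
    (forall rho, exists D, surrounded f rho D) ->
    (forall z, derive1 f z = 0 -> cmod (f z) <= K) ->
  polynomial f.
Proof.
move=> ef nc sur crit.
pose T := `|K| + 1; have T0 : 0 < T by rewrite ltr_wpDl.
have reg z : T <= cmod (f z) -> derive1 f z != 0.
  move=> fz; apply/eqP => /crit h; move: fz; rewrite /T.
  by have := ler_norm K; lra.
have [[z1 f1]|none] := pselect (exists z, cmod (f z) < T); last first.
  apply: (@polynomial_of_lower_bound _ f 0 T) => // z _.
  by rewrite leNgt; apply/negP => h; apply: none; exists z.
have [D sD] := sur (Num.max T (cmod z1)); have [_ [B DB] _ _] := sD.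
apply: (@polynomial_of_lower_bound _ f B T) => // z Bz.
rewrite leNgt; apply/negP => f2.
have [E [s [cE E1 E2 st fE]]] := linked_sublevel ef nc sur T0 reg f1 f2.
have := DB z; have Dz : D z.
  apply: (connected_in_surrounded sD cE E1) => //; first by rewrite le_max lexx orbT.
  by move=> y /fE h; rewrite lt_max (le_lt_trans h st).
by move=> /(_ Dz); lra.
Qed.

End SublevelSets.

Theorem theorem1p8 (R : realType) (f : R[i] -> R[i]) (r0 : R)
    (hf : transcendental_entire f)
    (hr0 : 0 < r0)
    (hM : forall r : R, r0 <= r -> r < max_modulus f r)
    (hweb : spiders_web (fast_escaping_level f r0)) :
  ~ (exists gamma : R -> R[i], path_to_infinity gamma /\ bounded_on_path f gamma)
  /\ ~ class_B f
  /\ ~ (exists alpha : R[i], exceptional_point f alpha).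
Proof.
have [ef npoly] := hf.
have nc : nonconstant f by move=> [c fc]; apply: npoly; exists c%:P => z; rewrite hornerC.
have sur rho : exists D, surrounded f rho D.
  exact: (spiders_web_surrounded rho ef nc hr0 hM hweb).
split; first exact: no_bounded_path.
split.
  move=> [_ /bounded_set_cmod[K hK]]; apply: npoly.
  apply: (polynomial_of_bounded_critical_values (K := K) ef nc sur) => z fz.
  by apply: hK; left; exists z.
move=> [al /finite_set_bounded[B hB]]; apply: npoly.
apply: (polynomial_of_bounded_fiber (al := al) (B := B) ef nc sur) => z fz.
(* The fibre of [al] is the term [n = 1] of its backwards orbit. *)
by apply: hB; exists 1%N.
Qed.
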